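(* Let $\alpha_2\approx 0.2797707433$ be the root in $[0,1]$ of $8\alpha^4-8\alpha^3+8\alpha^2=1/2$. For every $\alpha\in[\alpha_2,1/3]$, the map $G_\alpha$ admits an absolutely continuous invariant probability measure (with respect to two-dimensional Lebesgue measure on $[0,1]^2$).
   Context: Let $\tau:[0,1]\to[0,1]$ be the symmetric tent map, $\tau(x)=2x$ for $0\le x<1/2$ and $\tau(x)=2-2x$ for $1/2\le x\le 1$. For $0<\alpha<1$ define $G_\alpha:[0,1]^2\to[0,1]^2$ by $G_\alpha(x,y)=(y,\tau(\alpha y+(1-\alpha)x))$. *)

(* Defs.v *)
From Stdlib Require Import Reals.
Open Scope R_scope.

Definition tent (x : R) : R := if Rlt_dec x (1/2) then 2 * x else 2 - 2 * x.

Definition G (alpha : R) (p : R * R) : R * R :=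
  (snd p, tent (alpha * snd p + (1 - alpha) * fst p)).

Definition set2 := R * R -> Prop.

Definition unit_square : set2 :=
  fun p => 0 <= fst p <= 1 /\ 0 <= snd p <= 1.

Definition open_rect (a b c d : R) : set2 :=
  fun p => a < fst p < b /\ c < snd p < d.

Inductive borel : set2 -> Prop :=
  | borel_rect : forall a b c d, borel (open_rect a b c d)
  | borel_compl : forall A, borel A -> borel (fun p => ~ A p)
  | borel_union : forall A : nat -> set2, (forall n, borel (A n)) ->
      borel (fun p => exists n, A n p).

Definition lebesgue_null (A : set2) : Prop :=
  forall eps, 0 < eps ->
  exists a b c d : nat -> R,
    (forall n, a n <= b n /\ c n <= d n) /\
    (forall p, A p -> exists n, open_rect (a n) (b n) (c n) (d n) p) /\
    (forall N, sum_f_R0 (fun n => (b n - a n) * (d n - c n)) N <= eps).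

Definition borel_prob_on_square (mu : set2 -> R) : Prop :=
  (forall A, borel A -> 0 <= mu A) /\
  (forall A : nat -> set2,
     (forall n, borel (A n)) ->
     (forall m n p, m <> n -> A m p -> A n p -> False) ->
     infinite_sum (fun n => mu (A n)) (mu (fun p => exists n, A n p))) /\
  mu (fun _ => True) = 1 /\
  mu unit_square = 1.

Definition abs_continuous (mu : set2 -> R) : Prop :=
  forall A, borel A -> lebesgue_null A -> mu A = 0.

Definition invariant (F : R * R -> R * R) (mu : set2 -> R) : Prop :=
  forall A, borel A -> mu (fun p => unit_square p /\ A (F p)) = mu A.

Definition has_acip (F : R * R -> R * R) : Prop :=
  exists mu, borel_prob_on_square mu /\ abs_continuous mu /\ invariant F mu.

(* Main.v *)
(** Let [trap] be the part of the square above the segment from [(0, 2 al)] to [(1, 0)]: it is forward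
    invariant, and its orbits never make three consecutive steps to the left of the fold line, which is
    where [alpha2] comes from. The images of Lebesgue measure on [trap] under the iterates of the map
    have uniformly bounded densities. A generalized limit of their Cesaro averages is therefore
    dominated by a multiple of Lebesgue measure; this makes it countably additive and absolutely
    continuous, and it is clearly invariant.

    For the bound, let [jac = 2 (1 - al)] be the absolute value of the Jacobian determinant. The density
    of the [n]-th image is [jac ^ -n] times the number of [n]-th preimages in [trap], and it is constant off
    the first [n] images of the fold line and of the boundary of [trap]. In adapted quadratic norms
    segments of [trap] grow by a factor less than [jac] per step, and a short segment meets the fold line
    at most twice in five steps; since [4 < jac ^ 5], a segment breaks under [n] iterations into
    [O(kap ^ n)] pieces for some [kap < jac]. The jump of the density across a piece of the [j]-th image of
    the fold line is at most [2 jac ^ -j] times the supremum of an earlier density. The images of order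
    at most [J] form a finite arrangement whose faces contain squares of a fixed size, over which
    the density can be averaged, and if [J] is large, those of higher order contribute at most half of the
    supremum of the earlier densities. *)

Require Import Defs.
From Stdlib Require Import Reals Lra Lia List ClassicalEpsilon.
Open Scope R_scope.

(** * Counting binary words *)

Definition indic (P : Prop) : R := if excluded_middle_informative P then 1 else 0.

Lemma indic_true (P : Prop) : P -> indic P = 1.
Proof. unfold indic; destruct (excluded_middle_informative P); tauto. Qed.

Lemma indic_false (P : Prop) : ~ P -> indic P = 0.
Proof. unfold indic; destruct (excluded_middle_informative P); tauto. Qed.

Lemma indic_bounds (P : Prop) : 0 <= indic P <= 1.
Proof. unfold indic; destruct (excluded_middle_informative P); lra. Qed.

Lemma indic_mono (P Q : Prop) : (P -> Q) -> indic P <= indic Q.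
Proof.
intros H; unfold indic.
destruct (excluded_middle_informative P), (excluded_middle_informative Q); try lra; tauto.
Qed.

Fixpoint count_words (n : nat) (P : list bool -> Prop) : R :=
  match n with
  | O => indic (P nil)
  | S m => count_words m (fun v => P (true :: v)) + count_words m (fun v => P (false :: v))
  end.

Lemma count_words_mono n : forall P Q : list bool -> Prop,
  (forall v, length v = n -> P v -> Q v) -> count_words n P <= count_words n Q.
Proof.
induction n as [|n IH]; intros P Q H; simpl.
- apply indic_mono; auto.
- apply Rplus_le_compat; apply IH; intros v Hv; apply H; simpl; auto.
Qed.

Lemma count_words_ge0 n : forall P, 0 <= count_words n P.
Proof.
induction n as [|n IH]; intros P; simpl.
- apply indic_bounds.
- generalize (IH (fun v => P (true :: v))) (IH (fun v => P (false :: v))); lra.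
Qed.

Lemma count_words_empty n : forall P : list bool -> Prop,
  (forall v, length v = n -> ~ P v) -> count_words n P = 0.
Proof.
induction n as [|n IH]; intros P H; simpl.
- apply indic_false; auto.
- rewrite !IH; try lra; intros v Hv; apply H; simpl; auto.
Qed.

Lemma count_words_le_pow2 n : forall P, count_words n P <= 2 ^ n.
Proof.
induction n as [|n IH]; intros P; simpl.
- apply indic_bounds.
- generalize (IH (fun v => P (true :: v))) (IH (fun v => P (false :: v))); lra.
Qed.

(** The recursion of [count_words] removes the first letter, whereas the first branch taken by an
    orbit is the last letter of its word. *)
Lemma count_words_snoc n : forall P,
  count_words (S n) P =
  count_words n (fun v => P (v ++ true :: nil)) + count_words n (fun v => P (v ++ false :: nil)).
Proof.
induction n as [|n IH]; intros P.
- reflexivity.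
- change (count_words (S (S n)) P) with
    (count_words (S n) (fun v => P (true :: v)) + count_words (S n) (fun v => P (false :: v))).
  rewrite (IH (fun v => P (true :: v))), (IH (fun v => P (false :: v))); simpl; ring.
Qed.

Lemma count_words_or n : forall P Q : list bool -> Prop,
  count_words n (fun v => P v \/ Q v) <= count_words n P + count_words n Q.
Proof.
induction n as [|n IH]; intros P Q; simpl.
- unfold indic; destruct (excluded_middle_informative (P nil \/ Q nil)),
    (excluded_middle_informative (P nil)), (excluded_middle_informative (Q nil)); try lra; tauto.
- generalize (IH (fun v => P (true :: v)) (fun v => Q (true :: v)))
    (IH (fun v => P (false :: v)) (fun v => Q (false :: v))); lra.
Qed.

(** * Pieces of the images of a segment *)

Section Dynamics.
Variable al : R.

Definition wmean (z : R * R) : R := al * snd z + (1 - al) * fst z.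

(** [g true] and [g false] are the affine branches of [G al]. *)
Definition g (b : bool) (z : R * R) : R * R :=
  (snd z, if b then 2 * wmean z else 2 - 2 * wmean z).

Definition Dg (b : bool) (e : R * R) : R * R :=
  (snd e, if b then 2 * wmean e else - (2 * wmean e)).

(** The inverse of [g b]. *)
Definition h (b : bool) (z : R * R) : R * R :=
  (((if b then snd z / 2 else 1 - snd z / 2) - al * fst z) / (1 - al), fst z).

Definition jac : R := 2 * (1 - al).

Definition pt (p e : R * R) (t : R) : R * R := (fst p + t * fst e, snd p + t * snd e).

Definition scale (t : R) (e : R * R) : R * R := (t * fst e, t * snd e).

Definition seg (p e : R * R) : set2 := fun z => exists t, 0 <= t <= 1 /\ z = pt p e t.

(** [img X v] is the image of [X] under the branches read in [v] from right to left. *)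
Fixpoint img (X : set2) (v : list bool) : set2 :=
  match v with
  | nil => X
  | b :: v' => fun z => snd z < 1 /\ img X v' (h b z)
  end.

(** Pieces are indexed by itineraries: a word counts once as soon as some point of [X] follows
    it. *)
Definition laps (X : set2) (n : nat) : R := count_words n (fun v => exists z, img X v z).

Definition trap : set2 := fun z => 0 <= fst z <= 1 /\ snd z <= 1 /\ 2 * al * (1 - fst z) <= snd z.

Hypothesis al_lo : 279 / 1000 <= al.
Hypothesis al_hi : al <= 1 / 3.
Hypothesis al_eq : 1 / 2 <= 8 * al ^ 4 - 8 * al ^ 3 + 8 * al ^ 2.

Lemma jac_bounds : 4 / 3 <= jac <= 1442 / 1000.
Proof. unfold jac; lra. Qed.

Lemma g_h b z : g b (h b z) = z.
Proof. destruct z as [x y], b; unfold g, h, wmean; simpl; f_equal; field; lra. Qed.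

Lemma h_g b z : h b (g b z) = z.
Proof. destruct z as [x y], b; unfold g, h, wmean; simpl; f_equal; field; lra. Qed.

Lemma g_pt b p e t : g b (pt p e t) = pt (g b p) (Dg b e) t.
Proof. destruct p, e, b; unfold g, Dg, pt, wmean; simpl; f_equal; ring. Qed.

Lemma img_mono v : forall X Y : set2, (forall z, X z -> Y z) -> forall z, img X v z -> img Y v z.
Proof.
induction v as [|b v IH]; intros X Y H z; simpl; auto.
intros [H1 H2]; split; auto; eapply IH; eauto.
Qed.

Lemma img_snoc X b v : forall z,
  img X (v ++ b :: nil) z <-> img (fun y => snd y < 1 /\ X (h b y)) v z.
Proof.
induction v as [|c v IH]; intros z; simpl; [tauto|].
rewrite IH; tauto.
Qed.

Lemma laps_mono n (X Y : set2) : (forall z, X z -> Y z) -> laps X n <= laps Y n.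
Proof.
intros H; apply count_words_mono; intros v _ [z Hz]; exists z; eapply img_mono; eauto.
Qed.

Lemma img_empty v (X : set2) : (forall z, ~ X z) -> forall z, ~ img X v z.
Proof.
intros H; induction v as [|b v IH]; intros z; simpl; [apply H|].
intros [_ Hz]; exact (IH _ Hz).
Qed.

Lemma laps_empty n (X : set2) : (forall z, ~ X z) -> laps X n = 0.
Proof. intros H; apply count_words_empty; intros v _ [z Hz]; exact (img_empty v X H z Hz). Qed.

Lemma laps_S (X : set2) n :
  laps X (S n) = laps (fun y => snd y < 1 /\ X (h true y)) n + laps (fun y => snd y < 1 /\ X (h false y)) n.
Proof.
unfold laps; rewrite count_words_snoc.
f_equal; apply Rle_antisym; apply count_words_mono; intros v _ [z Hz]; exists z; apply img_snoc; exact Hz.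
Qed.

Lemma wmean_pt p e t : wmean (pt p e t) = wmean p + t * wmean e.
Proof. unfold wmean, pt; simpl; ring. Qed.

(** Both branches send the fold line to height 1, so the condition [snd z < 1] in [img] says that
    the preimage lies strictly on the side of its branch. *)
Lemma snd_g_lt b z : snd (g b z) < 1 <-> (if b then wmean z < 1/2 else 1/2 < wmean z).
Proof. destruct b; unfold g; simpl; lra. Qed.

Definition on (b : bool) (z : R * R) : Prop := if b then wmean z <= 1 / 2 else 1 / 2 <= wmean z.

Lemma trap_g b z : trap z -> on b z -> trap (g b z).
Proof.
destruct z as [x y]; unfold trap, on, g, wmean; simpl; intros (H1 & H2 & H3) H4.
assert (Hy : 0 <= y) by (assert (0 <= 2 * al * (1 - x)) by (apply Rmult_le_pos; lra); lra).
destruct b; simpl; repeat split; try lra.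
(* The height of the image above the lower edge is the sum of these three terms; the second one
   needs [1 / 4 <= al]. *)
- assert (0 <= 4 * al * (y - 2 * al * (1 - x))) by (apply Rmult_le_pos; lra).
  assert (0 <= (1 - x) * (al * (8 * al - 2))) by (apply Rmult_le_pos; [lra | apply Rmult_le_pos; lra]).
  assert (0 <= x * (2 - 4 * al)) by (apply Rmult_le_pos; lra).
  lra.
- assert (0 <= (1 - al) * (1 - x)) by (apply Rmult_le_pos; lra). lra.
Qed.

(** The other branch yields no word even if the segment touches the fold line, because [img] asks
    for strict inequalities. *)
Lemma laps_seg_on p e b n : on b p -> on b (pt p e 1) ->
  laps (seg p e) (S n) <= laps (seg (g b p) (Dg b e)) n.
Proof.
intros Hp He; rewrite laps_S.
assert (Hin : forall t, 0 <= t <= 1 -> on b (pt p e t)).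
{ intros t Ht; revert Hp He; unfold on; rewrite !wmean_pt; destruct b; nra. }
assert (Hs : laps (fun y => snd y < 1 /\ seg p e (h b y)) n <= laps (seg (g b p) (Dg b e)) n).
{ apply laps_mono; intros z [_ [t [Ht Hz]]]; exists t; split; auto.
  rewrite <- g_pt, <- Hz, g_h; reflexivity. }
assert (Ho : laps (fun y => snd y < 1 /\ seg p e (h (negb b) y)) n = 0).
{ apply laps_empty; intros z [Hz1 [t [Ht Hz]]].
  rewrite <- (g_h (negb b) z), snd_g_lt, Hz in Hz1.
  generalize (Hin t Ht); unfold on; destruct b; simpl in Hz1; lra. }
destruct b; simpl in Ho; lra.
Qed.

Lemma laps_seg_cut p e b t n : 0 < t < 1 -> on b p -> wmean (pt p e t) = 1 / 2 ->
  on (negb b) (pt p e 1) ->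
  laps (seg p e) (S n) <= laps (seg (g b p) (Dg b (scale t e))) n
    + laps (seg (g (negb b) (pt p e t)) (Dg (negb b) (scale (1 - t) e))) n.
Proof.
intros Ht Hp Hm He; rewrite laps_S.
assert (H1 : laps (fun y => snd y < 1 /\ seg p e (h b y)) n <= laps (seg (g b p) (Dg b (scale t e))) n).
{ apply laps_mono; intros z [Hz1 [s [Hs Hz]]]; exists (s / t).
  rewrite <- g_pt.
  assert (Heq : pt p (scale t e) (s / t) = pt p e s).
  { unfold pt, scale; simpl; f_equal; field; lra. }
  rewrite Heq, <- Hz, g_h; split; auto.
  rewrite <- (g_h b z), snd_g_lt, Hz in Hz1.
  revert Hp Hm He Hz1; unfold on; rewrite !wmean_pt; intros.
  split; [apply Rle_mult_inv_pos; lra|].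
  apply Rmult_le_reg_r with t; [lra|].
  replace (s / t * t) with s by (field; lra).
  destruct b; simpl in *; nra. }
assert (H2 : laps (fun y => snd y < 1 /\ seg p e (h (negb b) y)) n
    <= laps (seg (g (negb b) (pt p e t)) (Dg (negb b) (scale (1 - t) e))) n).
{ apply laps_mono; intros z [Hz1 [s [Hs Hz]]]; exists ((s - t) / (1 - t)).
  rewrite <- g_pt.
  assert (Heq : pt (pt p e t) (scale (1 - t) e) ((s - t) / (1 - t)) = pt p e s).
  { unfold pt, scale; simpl; f_equal; field; lra. }
  rewrite Heq, <- Hz, g_h; split; auto.
  rewrite <- (g_h (negb b) z), snd_g_lt, Hz in Hz1.
  revert Hp Hm He Hz1; unfold on; rewrite !wmean_pt; intros.
  assert (t <= s) by (destruct b; simpl in *; nra).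
  split; [apply Rle_mult_inv_pos; lra|].
  apply Rmult_le_reg_r with (1 - t); [lra|].
  replace ((s - t) / (1 - t) * (1 - t)) with (s - t) by (field; lra). lra. }
destruct b; simpl in *; lra.
Qed.

(** * Growth of segments in adapted quadratic norms *)

Inductive st := SA | SB | SC | SD.

(** The state is the pair of the last two branches, older one first: [SA] is false false, [SB] true
    false, [SC] false true, [SD] true true. *)
Definition next (s : st) (b : bool) : st :=
  match s, b with
  | SA, false | SB, false => SA
  | SC, false | SD, false => SB
  | SA, true | SB, true => SC
  | SC, true | SD, true => SD
  end.

(** Found numerically so as to satisfy [qform_Dg]. *)
Definition qform (s : st) (e : R * R) : R :=
  let (x, y) := e in
  match s with
  | SA => 29 * x ^ 2 + 14 * x * y + 28 * y ^ 2
  | SB => 37 * x ^ 2 + 28 * x * y + 22 * y ^ 2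
  | SC => 28 * x ^ 2 - 2 * x * y + 25 * y ^ 2
  | SD => 25 * x ^ 2 - 2 * x * y + 17 * y ^ 2
  end.

(** [rho] bounds the growth of the adapted norms per step, [kap] that of the number of pieces; the
    gap between them pays for cutting long segments. *)
Definition rho : R := 996 / 1000 * jac.
Definition kap : R := 998 / 1000 * jac.

Lemma psd (a b c x y : R) : 0 < a -> b * b <= a * c -> 0 <= a * x ^ 2 + 2 * b * x * y + c * y ^ 2.
Proof.
intros Ha Hd.
apply Rmult_le_reg_l with a; [exact Ha|].
replace (a * (a * x ^ 2 + 2 * b * x * y + c * y ^ 2))
  with ((a * x + b * y) ^ 2 + (a * c - b * b) * y ^ 2) by ring.
assert (0 <= (a * c - b * b) * y ^ 2) by (apply Rmult_le_pos; [lra | apply pow2_ge_0]).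
generalize (pow2_ge_0 (a * x + b * y)); lra.
Qed.

Lemma quad_le (a b c a' b' c' r x y : R) :
  0 < r * a - a' -> (r * b - b') * (r * b - b') <= (r * a - a') * (r * c - c') ->
  a' * x ^ 2 + 2 * b' * x * y + c' * y ^ 2 <= r * (a * x ^ 2 + 2 * b * x * y + c * y ^ 2).
Proof. intros H1 H2; generalize (psd _ _ _ x y H1 H2); lra. Qed.

(** The substitution [al = 1 / 3 - k] makes all the discriminants visibly positive. *)
Lemma qform_Dg s b e : (s = SD -> b = false) -> qform (next s b) (Dg b e) <= rho ^ 2 * qform s e.
Proof.
intros Hs; destruct e as [x y].
(* [544 / 10000] bounds [1 / 3 - 279 / 1000]. The powers of [k] are then bounded linearly, for use
   in the discriminants, which have degree at most four. *)
assert (Hk : exists k, 0 <= k <= 544 / 10000 /\ al = 1 / 3 - k).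
{ exists (1 / 3 - al); split; [lra|ring]. }
destruct Hk as [k [Hk Ha]].
assert (H2 : 0 <= k ^ 2 <= 544 / 10000 * k) by nra.
assert (H3 : 0 <= k ^ 3 <= (544 / 10000) ^ 2 * k) by nra.
assert (H4 : 0 <= k ^ 4 <= (544 / 10000) ^ 3 * k) by nra.
set (m := 2 / 3 + k).
assert (Hr : rho ^ 2 = (996 / 1000) ^ 2 * 4 * m ^ 2) by (unfold rho, jac, m; rewrite Ha; field).
assert (Hu : wmean (x, y) = (1 / 3 - k) * y + m * x) by (unfold wmean, m; simpl; rewrite Ha; field).
rewrite Hr; unfold Dg; rewrite Hu; clear Hu Hr; unfold m; clear m.
destruct s, b; unfold next, qform; simpl fst; simpl snd;
  try (specialize (Hs eq_refl); discriminate).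
(* In every case the first triple of coefficients is [qform s] and the second is [qform (next s b)]
   expanded at [Dg b e], with halved cross coefficients. *)
- eapply Rle_trans; [|eapply Rle_trans; [apply (quad_le 29 (7) 28 (100 * (2 / 3 + k) ^ 2) (-2 * (2 / 3 + k) + 100 * (1 / 3 - k) * (2 / 3 + k)) (28 + -4 * (1 / 3 - k) + 100 * (1 / 3 - k) ^ 2)
    ((996 / 1000) ^ 2 * 4 * (2 / 3 + k) ^ 2) x y); nra|]]; right; ring.
- eapply Rle_trans; [|eapply Rle_trans; [apply (quad_le 29 (7) 28 (112 * (2 / 3 + k) ^ 2) (-14 * (2 / 3 + k) + 112 * (1 / 3 - k) * (2 / 3 + k)) (29 + -28 * (1 / 3 - k) + 112 * (1 / 3 - k) ^ 2)
    ((996 / 1000) ^ 2 * 4 * (2 / 3 + k) ^ 2) x y); nra|]]; right; ring.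
- eapply Rle_trans; [|eapply Rle_trans; [apply (quad_le 37 (14) 22 (100 * (2 / 3 + k) ^ 2) (-2 * (2 / 3 + k) + 100 * (1 / 3 - k) * (2 / 3 + k)) (28 + -4 * (1 / 3 - k) + 100 * (1 / 3 - k) ^ 2)
    ((996 / 1000) ^ 2 * 4 * (2 / 3 + k) ^ 2) x y); nra|]]; right; ring.
- eapply Rle_trans; [|eapply Rle_trans; [apply (quad_le 37 (14) 22 (112 * (2 / 3 + k) ^ 2) (-14 * (2 / 3 + k) + 112 * (1 / 3 - k) * (2 / 3 + k)) (29 + -28 * (1 / 3 - k) + 112 * (1 / 3 - k) ^ 2)
    ((996 / 1000) ^ 2 * 4 * (2 / 3 + k) ^ 2) x y); nra|]]; right; ring.
- eapply Rle_trans; [|eapply Rle_trans; [apply (quad_le 28 (-1) 25 (68 * (2 / 3 + k) ^ 2) (-2 * (2 / 3 + k) + 68 * (1 / 3 - k) * (2 / 3 + k)) (25 + -4 * (1 / 3 - k) + 68 * (1 / 3 - k) ^ 2)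
    ((996 / 1000) ^ 2 * 4 * (2 / 3 + k) ^ 2) x y); nra|]]; right; ring.
- eapply Rle_trans; [|eapply Rle_trans; [apply (quad_le 28 (-1) 25 (88 * (2 / 3 + k) ^ 2) (-28 * (2 / 3 + k) + 88 * (1 / 3 - k) * (2 / 3 + k)) (37 + -56 * (1 / 3 - k) + 88 * (1 / 3 - k) ^ 2)
    ((996 / 1000) ^ 2 * 4 * (2 / 3 + k) ^ 2) x y); nra|]]; right; ring.
- eapply Rle_trans; [|eapply Rle_trans; [apply (quad_le 25 (-1) 17 (88 * (2 / 3 + k) ^ 2) (-28 * (2 / 3 + k) + 88 * (1 / 3 - k) * (2 / 3 + k)) (37 + -56 * (1 / 3 - k) + 88 * (1 / 3 - k) ^ 2)
    ((996 / 1000) ^ 2 * 4 * (2 / 3 + k) ^ 2) x y); nra|]]; right; ring.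
Qed.

(** The point reached by undoing the most recent [true] branches that [s] records. *)
Definition pre (s : st) (z : R * R) : R * R :=
  match s with SA | SB => z | SC => h true z | SD => h true (h true z) end.

(** A segment of the trapping region whose last symbols are recorded by [s]:
    they end with [22] or [12] (up to the beginning) for [SA] and [SB], with [21] for [SC]
    and with [211] for [SD], where [1] stands for [true]. *)
Definition St (s : st) (p e : R * R) (nu : R) : Prop :=
  trap p /\ trap (pt p e 1) /\ trap (pre s p) /\ trap (pre s (pt p e 1)) /\ qform s e <= nu ^ 2 /\ 0 <= nu.

Definition delta (z z' : R * R) : R * R := (fst z' - fst z, snd z' - snd z).

Lemma pt_delta z z' : pt z (delta z z') 1 = z'.
Proof. destruct z, z'; unfold pt, delta; simpl; f_equal; ring. Qed.

Lemma delta_pt p e : delta p (pt p e 1) = e.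
Proof. destruct p, e; unfold pt, delta; simpl; f_equal; ring. Qed.

Lemma h_delta b z z' t : h b (pt z (delta z z') t) = pt (h b z) (delta (h b z) (h b z')) t.
Proof. destruct z, z', b; unfold h, pt, delta; simpl; f_equal; field; lra. Qed.

Lemma trap_conv z z' t : trap z -> trap z' -> 0 <= t <= 1 -> trap (pt z (delta z z') t).
Proof.
destruct z as [x y], z' as [x' y']; unfold trap, pt, delta; simpl; intros H H' Ht.
assert (C : forall a b c, a <= c -> b <= c -> a + t * (b - a) <= c) by (intros; nra).
assert (C' : forall a b c, c <= a -> c <= b -> c <= a + t * (b - a)) by (intros; nra).
repeat split; try (apply C; tauto); try (apply C'; tauto).
enough (0 <= (y - 2 * al * (1 - x)) + t * ((y' - 2 * al * (1 - x')) - (y - 2 * al * (1 - x)))) by lra.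
apply C'; lra.
Qed.

Lemma pre_conv s z z' t : trap (pre s z) -> trap (pre s z') -> 0 <= t <= 1 ->
  trap (pre s (pt z (delta z z') t)).
Proof. destruct s; simpl; intros; rewrite ?h_delta; apply trap_conv; auto. Qed.

Lemma qform_sc s t e : qform s (scale t e) = t ^ 2 * qform s e.
Proof. destruct e, s; unfold qform, scale; simpl; ring. Qed.

(** The state passes to subsegments because [trap] and the set of [z] with [trap (pre s z)] are
    convex. *)
Lemma St_sub s p e nu a l : St s p e nu -> 0 <= a -> 0 <= l -> a + l <= 1 ->
  St s (pt p e a) (scale l e) (l * nu).
Proof.
intros (H1 & H2 & H3 & H4 & H5 & H6) Ha Hl Hal.
assert (E1 : forall t, pt p e t = pt p (delta p (pt p e 1)) t) by (intros t; rewrite delta_pt; auto).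
assert (E2 : pt (pt p e a) (scale l e) 1 = pt p (delta p (pt p e 1)) (a + l)).
{ rewrite delta_pt; unfold pt, scale; simpl; f_equal; ring. }
unfold St; rewrite E2, (E1 a).
repeat split; try (apply trap_conv; auto; lra); try (apply pre_conv; auto; lra).
- rewrite qform_sc; replace ((l * nu) ^ 2) with (l ^ 2 * nu ^ 2) by ring.
  apply Rmult_le_compat_l; auto; apply pow2_ge_0.
- apply Rmult_le_pos; auto.
Qed.

Lemma St_step s p e nu b : St s p e nu -> on b p -> on b (pt p e 1) -> (s = SD -> b = false) ->
  St (next s b) (g b p) (Dg b e) (rho * nu).
Proof.
intros (H1 & H2 & H3 & H4 & H5 & H6) Hp He Hs.
assert (Hr : 0 <= rho) by (unfold rho; generalize jac_bounds; lra).
assert (P : forall z, trap z -> trap (pre s z) -> on b z -> trap (pre (next s b) (g b z))).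
{ intros z Hz Hz' Hb; destruct s, b; simpl in *; rewrite ?h_g; auto; try (apply trap_g; auto; fail).
  specialize (Hs eq_refl); discriminate. }
unfold St; rewrite <- (g_pt b p e 1).
repeat split; try (apply trap_g; auto; fail); try (apply P; auto; fail).
- eapply Rle_trans; [apply qform_Dg; auto|].
  replace ((rho * nu) ^ 2) with (rho ^ 2 * nu ^ 2) by ring.
  apply Rmult_le_compat_l; auto; apply pow2_ge_0.
- apply Rmult_le_pos; auto.
Qed.

(** Three consecutive points of an orbit in the trapping region are not all left of the fold;
    this is what the lower bound on [al] is for. *)
Lemma SD_on z : trap (pre SD z) -> on false z.
Proof.
simpl; intros H; rewrite <- (g_h true z), <- (g_h true (h true z)).
destruct (h true (h true z)) as [x y]; revert H; unfold trap, on, g, wmean; simpl; intros (H1 & H2 & H3).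
(* After two [true] branches from [(x, y)], the value of [wmean] is
   [c * wmean (x, y) + 2 * al * (1 - al) * y]. On the lower edge of [trap] it is affine in [x], at
   least [8 / 9] at [x = 1] and equal to the polynomial of [al_eq] at [x = 0]. *)
set (c := 4 * al ^ 2 + 2 - 2 * al).
assert (Hc : 4 / 3 <= c) by (unfold c; nra).
replace (al * (2 * (al * (2 * (al * y + (1 - al) * x)) + (1 - al) * y)) +
  (1 - al) * (2 * (al * y + (1 - al) * x)))
  with ((c * al + 2 * al * (1 - al)) * y + c * (1 - al) * x) by (unfold c; ring).
assert (0 <= c * al + 2 * al * (1 - al)) by nra.
assert (2 / 3 * (4 / 3) <= c * (1 - al)) by nra.
assert ((c * al + 2 * al * (1 - al)) * (2 * al * (1 - x)) <= (c * al + 2 * al * (1 - al)) * y)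
  by (apply Rmult_le_compat_l; lra).
assert (E : (c * al + 2 * al * (1 - al)) * (2 * al) = 8 * al ^ 4 - 8 * al ^ 3 + 8 * al ^ 2)
  by (unfold c; ring).
nra.
Qed.

(** Each of the four forms dominates the squares of both coordinates. *)
Lemma St_size s p e nu : St s p e nu -> - nu <= fst e <= nu /\ - nu <= snd e <= nu.
Proof.
intros (_ & _ & _ & _ & H5 & H6); destruct e as [x y]; simpl.
assert (H : x ^ 2 <= nu ^ 2 /\ y ^ 2 <= nu ^ 2).
{ clear H6; destruct s; simpl qform in H5; split;
  generalize (pow2_ge_0 (x + y)), (pow2_ge_0 (x - y)), (pow2_ge_0 x), (pow2_ge_0 y); nra. }
split; split; nra.
Qed.

Lemma St_wmean s p e nu : St s p e nu -> - nu <= wmean e <= nu.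
Proof.
intros H; destruct (St_size _ _ _ _ H) as [H1 H2]; unfold wmean; nra.
Qed.

(** [wmean] is affine along the segment, so a segment with ends strictly on both sides is cut at a
    single point. In state [SD] there is no cut, since [SD_on] puts both ends on the right. *)
Lemma step_cases s p e nu : St s p e nu ->
  (exists b, (s = SD -> b = false) /\ on b p /\ on b (pt p e 1)) \/
  (exists t b, 0 < t < 1 /\ s <> SD /\ wmean (pt p e t) = 1 / 2 /\ on b p /\ on (negb b) (pt p e 1)).
Proof.
intros (H1 & H2 & H3 & H4 & H5 & H6).
assert (HD : s = SD -> on false p /\ on false (pt p e 1)).
{ intros ->; split; apply SD_on; auto. }
assert (Hs : s = SD \/ s <> SD) by (destruct s; (left; reflexivity) || (right; discriminate)).
destruct Hs as [Hs|Hs].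
{ left; exists false; tauto. }
assert (Hc : forall b, on b p /\ on b (pt p e 1) ->
  exists b, (s = SD -> b = false) /\ on b p /\ on b (pt p e 1)).
{ intros b Hb; exists b; tauto. }
unfold on in *; rewrite !wmean_pt in *.
destruct (Rle_dec (wmean p) (1 / 2)) as [L|L], (Rle_dec (1 / 2) (wmean p)) as [L'|L'],
  (Rle_dec (wmean p + 1 * wmean e) (1 / 2)) as [K|K], (Rle_dec (1 / 2) (wmean p + 1 * wmean e)) as [K'|K'];
  try lra; try (left; apply (Hc true); lra); try (left; apply (Hc false); lra);
  right; exists ((1 / 2 - wmean p) / wmean e).
- exists true; rewrite wmean_pt; simpl; repeat split; auto; try lra.
  + apply Rdiv_lt_0_compat; lra.
  + apply Rmult_lt_reg_r with (wmean e); [lra|].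
    replace ((1 / 2 - wmean p) / wmean e * wmean e) with (1 / 2 - wmean p) by (field; lra); lra.
  + field; lra.
- exists false; rewrite wmean_pt; simpl; repeat split; auto; try lra.
  + replace ((1 / 2 - wmean p) / wmean e) with ((wmean p - 1 / 2) / - wmean e) by (field; lra).
    apply Rdiv_lt_0_compat; lra.
  + apply Rmult_lt_reg_r with (- wmean e); [lra|].
    replace ((1 / 2 - wmean p) / wmean e * - wmean e) with (wmean p - 1 / 2) by (field; lra); lra.
  + field; lra.
Qed.

(** * Cuts and the number of pieces *)

Definition ends (P : R * R -> Prop) (p e : R * R) : Prop := P p /\ P (pt p e 1).

Lemma advance s p e nu b : St s p e nu -> (s = SD -> b = false) -> ends (on b) p e ->
  exists p' e', St (next s b) p' e' (rho * nu) /\ p' = g b p /\ pt p' e' 1 = g b (pt p e 1) /\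
    forall n, laps (seg p e) (S n) <= laps (seg p' e') n.
Proof.
intros H Hs [H1 H2]; exists (g b p), (Dg b e).
split; [apply St_step; auto|split; [reflexivity|split]].
- symmetry; apply g_pt.
- intros n; apply laps_seg_on; auto.
Qed.

(** The segment meets the fold line and [wmean] varies by at most [nu] along it, so its image lies
    within [2 * nu] of height 1. The bound [c] on heights becomes one on abscissas because [g] moves
    the second coordinate to the first. *)
Lemma cut s p e nu t b c : St s p e nu -> s <> SD -> 0 < t < 1 -> wmean (pt p e t) = 1 / 2 ->
  on b p -> on (negb b) (pt p e 1) -> ends (fun z => c <= snd z) p e ->
  exists s1 p1 e1 s2 p2 e2, St s1 p1 e1 (rho * (t * nu)) /\ St s2 p2 e2 (rho * ((1 - t) * nu)) /\
    ends (fun z => c <= fst z /\ 1 - 2 * nu <= snd z) p1 e1 /\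
    ends (fun z => c <= fst z /\ 1 - 2 * nu <= snd z) p2 e2 /\
    forall n, laps (seg p e) (S n) <= laps (seg p1 e1) n + laps (seg p2 e2) n.
Proof.
intros H Hs Ht Hm Hp He [Hc1 Hc2].
assert (Hz : forall r b', 0 <= r <= 1 ->
  c <= fst (g b' (pt p e r)) /\ 1 - 2 * nu <= snd (g b' (pt p e r))).
{ intros r b' Hr; split.
  - revert Hc1 Hc2; unfold g, pt; simpl; intros; nra.
  - assert (Hu : - nu <= wmean (pt p e r) - 1 / 2 <= nu).
    { generalize (St_wmean _ _ _ _ H); rewrite <- Hm, !wmean_pt; intros; nra. }
    destruct b'; unfold g; simpl; lra. }
assert (E0 : pt p e 0 = p) by (destruct p; unfold pt; simpl; f_equal; ring).
assert (E1 : pt p (scale t e) 1 = pt p e t) by (unfold pt, scale; simpl; f_equal; ring).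
assert (E2 : pt (pt p e t) (scale (1 - t) e) 1 = pt p e 1) by (unfold pt, scale; simpl; f_equal; ring).
assert (S1 : St s p (scale t e) (t * nu)).
{ rewrite <- E0 at 1; apply St_sub; auto; lra. }
assert (S2 : St s (pt p e t) (scale (1 - t) e) ((1 - t) * nu)).
{ apply St_sub; auto; lra. }
exists (next s b), (g b p), (Dg b (scale t e)), (next s (negb b)), (g (negb b) (pt p e t)),
  (Dg (negb b) (scale (1 - t) e)).
assert (Om : forall b', on b' (pt p e t)) by (intros []; unfold on; lra).
split; [|split; [|split; [|split]]].
- apply St_step; auto; [rewrite E1; auto | tauto].
- apply St_step; auto; [rewrite E2; auto | tauto].
- split; [rewrite <- E0; apply Hz; lra | rewrite <- g_pt, E1; apply Hz; lra].
- split; [apply Hz; lra | rewrite <- g_pt, E2; apply Hz; lra].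
- intros n; apply laps_seg_cut; auto.
Qed.

Lemma on_right z : trap z -> 96 / 100 <= fst z -> on false z.
Proof.
destruct z as [x y]; unfold trap, on, wmean; simpl; intros (H1 & H2 & H3) H4.
assert (0 <= 2 * al * (1 - x)) by (apply Rmult_le_pos; lra).
assert (0 <= al * y) by (apply Rmult_le_pos; lra).
assert (2 / 3 * (96 / 100) <= (1 - al) * x) by (apply Rmult_le_compat; lra).
lra.
Qed.

(** The corner [(1, 1)] goes to [(1, 0)] and then to [(0, 2 * al)], where [wmean] is [2 * al ^ 2],
    well below [1 / 2]; this lemma and the next two follow a neighbourhood of that orbit. *)
Lemma near_corner z : 96 / 100 <= fst z -> 96 / 100 <= snd z ->
  96 / 100 <= fst (g false z) /\ snd (g false z) <= 8 / 100.
Proof.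
destruct z as [x y]; unfold g, wmean; simpl; intros H1 H2; split; auto.
assert (al * (96 / 100) <= al * y) by (apply Rmult_le_compat_l; lra).
assert ((1 - al) * (96 / 100) <= (1 - al) * x) by (apply Rmult_le_compat_l; lra).
lra.
Qed.

Lemma near_bottom z : trap z -> 96 / 100 <= fst z /\ snd z <= 8 / 100 ->
  fst (g false z) <= 8 / 100 /\ snd (g false z) <= 2 - 2 * (1 - al) * (96 / 100).
Proof.
destruct z as [x y]; unfold g, wmean, trap; simpl; intros (H1 & H2 & H3) [H4 H5]; split; auto.
assert (0 <= 2 * al * (1 - x)) by (apply Rmult_le_pos; lra).
assert (0 <= al * y) by (apply Rmult_le_pos; lra).
assert ((1 - al) * (96 / 100) <= (1 - al) * x) by (apply Rmult_le_compat_l; lra).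
lra.
Qed.

Lemma on_left z : fst z <= 8 / 100 /\ snd z <= 2 - 2 * (1 - al) * (96 / 100) -> on true z.
Proof.
destruct z as [x y]; unfold on, wmean; simpl; intros [H1 H2].
assert (al * y <= al * (2 - 2 * (1 - al) * (96 / 100))) by (apply Rmult_le_compat_l; lra).
assert ((1 - al) * x <= (1 - al) * (8 / 100)) by (apply Rmult_le_compat_l; lra).
assert (0 <= (1 / 3 - al) * al) by (apply Rmult_le_pos; lra).
lra.
Qed.

Lemma St_ends s p e nu : St s p e nu -> ends trap p e.
Proof. intros H; split; apply H. Qed.

Lemma kap_bounds : 133 / 100 <= kap <= 144 / 100 /\ 0 <= rho /\ rho + 266 / 100000 <= kap.
Proof. unfold kap, rho; generalize jac_bounds; lra. Qed.

Lemma laps_le_pow2 X n : laps X n <= 2 ^ n.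
Proof. apply count_words_le_pow2. Qed.

(** A short segment that has just been cut lies near the top side. If it is cut again, its pieces pass
    near [(1, 1)], [(1, 0)] and [(0, 2 al)], away from the fold line; otherwise its image lies near
    the right side, away from the fold line. *)
Lemma laps_near_top m :
  (forall k s p e nu, (k < m + 5)%nat -> St s p e nu ->
     laps (seg p e) k <= 16 * kap ^ k * (1 + 30000 * nu)) ->
  forall s p e nu, St s p e nu -> nu <= 2 / 100 -> ends (fun z => 98 / 100 <= snd z) p e ->
  laps (seg p e) (m + 4) <= 16 * kap ^ (m + 4) * (kap / 2 + 30000 * nu).
Proof.
intros IH s p e nu H Hn Ht.
destruct kap_bounds as (Hk & Hr & Hrk).
assert (Hkm : 0 < kap ^ m) by (apply pow_lt; lra).
assert (Hnu : 0 <= nu) by apply H.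
assert (Hk2 : 176 / 100 <= kap ^ 2) by nra.
(* The term [kap / 2] of the claim needs [2 <= kap ^ 3] if two steps pass without a cut, and
   [4 <= kap ^ 5] if there is a second cut. *)
assert (Hk3 : 2 <= kap ^ 3) by nra.
assert (Hk5 : 4 <= kap ^ 5) by nra.
replace (kap ^ (m + 4)) with (kap ^ m * kap ^ 4) by (rewrite pow_add; ring).
destruct (step_cases _ _ _ _ H) as [(b & Hs & Hb)|(t & b & Ht1 & Hs & Hm & Hb1 & Hb2)].
- destruct (advance _ _ _ _ b H Hs Hb) as (p1 & e1 & H1 & Ep1 & Ee1 & L1).
  assert (O1 : ends (on false) p1 e1).
  { destruct (St_ends _ _ _ _ H1) as [T1 T2], Ht as [Ht Ht'].
    split; apply on_right; auto; rewrite ?Ee1, ?Ep1; unfold g, fst; lra. }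
  destruct (advance _ _ _ _ false H1 (fun _ => eq_refl) O1) as (p2 & e2 & H2 & _ & _ & L2).
  specialize (L1 (m + 3)%nat); specialize (L2 (m + 2)%nat).
  specialize (IH (m + 2)%nat _ _ _ _ ltac:(lia) H2).
  replace (S (m + 3)) with (m + 4)%nat in L1 by lia.
  replace (S (m + 2)) with (m + 3)%nat in L2 by lia.
  eapply Rle_trans; [exact L1|]; eapply Rle_trans; [exact L2|]; eapply Rle_trans; [exact IH|].
  replace (kap ^ (m + 2)) with (kap ^ m * kap ^ 2) by (rewrite pow_add; ring).
  assert (rho * (rho * nu) <= kap ^ 2 * nu).
  { rewrite <- Rmult_assoc; apply Rmult_le_compat_r; nra. }
  replace (16 * (kap ^ m * kap ^ 4) * (kap / 2 + 30000 * nu))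
    with (16 * kap ^ m * (kap ^ 2 * (kap ^ 3 / 2 + 30000 * (kap ^ 2 * nu)))) by field.
  replace (16 * (kap ^ m * kap ^ 2) * (1 + 30000 * (rho * (rho * nu))))
    with (16 * kap ^ m * (kap ^ 2 * (1 + 30000 * (rho * (rho * nu))))) by field.
  apply Rmult_le_compat_l; [lra|]; apply Rmult_le_compat_l; lra.
- destruct (cut _ _ _ _ _ _ _ H Hs Ht1 Hm Hb1 Hb2 Ht)
    as (s1 & p1 & e1 & s2 & p2 & e2 & H1 & H2 & N1 & N2 & L).
  (* A piece of the second cut makes three unbroken steps, through the branches [false], [false],
     [true]; with the cut itself this leaves [m] of the [m + 4] iterations. *)
  assert (Q : forall s p e nu', St s p e nu' ->
    ends (fun z => 98 / 100 <= fst z /\ 1 - 2 * nu <= snd z) p e ->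
    laps (seg p e) (m + 3) <= 16 * kap ^ m * (1 + 30000 * (rho * (rho * (rho * nu'))))).
  { clear - IH Hn Hnu al_lo al_hi al_eq Hk; intros s p e nu' H N.
    assert (O1 : ends (on false) p e).
    { destruct (St_ends _ _ _ _ H), N; split; apply on_right; auto; lra. }
    destruct (advance _ _ _ _ false H (fun _ => eq_refl) O1) as (p1 & e1 & H1 & Ep1 & Ee1 & L1).
    assert (N1 : ends (fun z => 96 / 100 <= fst z /\ snd z <= 8 / 100) p1 e1).
    { destruct (St_ends _ _ _ _ H), N as [N N']; unfold ends; rewrite Ee1, Ep1.
      split; apply near_corner; auto; lra. }
    assert (O2 : ends (on false) p1 e1).
    { destruct (St_ends _ _ _ _ H1), N1; split; apply on_right; auto; lra. }
    destruct (advance _ _ _ _ false H1 (fun _ => eq_refl) O2) as (p2 & e2 & H2 & Ep2 & Ee2 & L2).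
    assert (N2 : ends (fun z => fst z <= 8 / 100 /\ snd z <= 2 - 2 * (1 - al) * (96 / 100)) p2 e2).
    { destruct (St_ends _ _ _ _ H1), N1 as [N1 N1']; unfold ends; rewrite Ee2, Ep2.
      split; apply near_bottom; auto. }
    assert (O3 : ends (on true) p2 e2).
    { destruct N2; split; apply on_left; auto. }
    destruct (advance _ _ _ _ true H2) as (p3 & e3 & H3 & _ & _ & L3).
    { destruct s; discriminate. }
    { exact O3. }
    specialize (L1 (m + 2)%nat); specialize (L2 (m + 1)%nat); specialize (L3 m).
    specialize (IH m _ _ _ _ ltac:(lia) H3).
    replace (S (m + 2)) with (m + 3)%nat in L1 by lia.
    replace (S (m + 1)) with (m + 2)%nat in L2 by lia.
    replace (S m) with (m + 1)%nat in L3 by lia.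
    lra. }
  specialize (Q _ _ _ _ H1 N1) as Q1; specialize (Q _ _ _ _ H2 N2) as Q2.
  specialize (L (m + 3)%nat); replace (S (m + 3)) with (m + 4)%nat in L by lia.
  eapply Rle_trans; [exact L|].
  eapply Rle_trans; [apply Rplus_le_compat; [exact Q1|exact Q2]|].
  assert (Hr2 : 0 <= rho * rho <= kap * kap) by nra.
  assert (Hr4 : rho * rho * (rho * rho) * nu <= kap * kap * (kap * kap) * nu).
  { apply Rmult_le_compat_r; auto; apply Rmult_le_compat; lra. }
  replace (16 * (kap ^ m * kap ^ 4) * (kap / 2 + 30000 * nu))
    with (16 * kap ^ m * (kap ^ 5 / 2 + 30000 * (kap * kap * (kap * kap) * nu))) by field.
  replace (16 * kap ^ m * (1 + 30000 * (rho * (rho * (rho * (rho * (t * nu)))))) +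
    16 * kap ^ m * (1 + 30000 * (rho * (rho * (rho * (rho * ((1 - t) * nu)))))))
    with (16 * kap ^ m * (2 + 30000 * (rho * rho * (rho * rho) * nu))) by ring.
  apply Rmult_le_compat_l; lra.
Qed.

(** By strong induction. A long segment pays for a cut with the linear term, since [rho < kap]; the
    pieces of a short one fall under [laps_near_top], and their two terms [kap / 2] add up to the
    required [kap]. *)
Lemma laps_segment n : forall s p e nu, St s p e nu -> laps (seg p e) n <= 16 * kap ^ n * (1 + 30000 * nu).
Proof.
destruct kap_bounds as (Hk & Hr & Hrk).
induction n as [n IH] using (well_founded_induction Wf_nat.lt_wf); intros s p e nu H.
assert (Hnu : 0 <= nu) by apply H.
destruct (Compare_dec.le_lt_dec 5 n) as [Hn|Hn].
(* For [n < 5] the trivial bound [2 ^ n] suffices, whence the constant [16]. *)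
2:{ apply Rle_trans with 16.
  - apply Rle_trans with (2 ^ n); [apply laps_le_pow2|].
    replace 16 with (2 ^ 4) by ring; apply Rle_pow; [lra|lia].
  - assert (1 <= kap ^ n) by (apply pow_R1_Rle; lra).
    rewrite <- (Rmult_1_r 16) at 1; rewrite Rmult_assoc; apply Rmult_le_compat_l; [lra|].
    rewrite <- (Rmult_1_r 1) at 1; apply Rmult_le_compat; lra. }
assert (exists m, n = (m + 5)%nat) as [m ->] by (exists (n - 5)%nat; lia).
assert (Hkm : 0 < kap ^ (m + 4)) by (apply pow_lt; lra).
replace (kap ^ (m + 5)) with (kap ^ (m + 4) * kap) by (rewrite !pow_add; ring).
destruct (step_cases _ _ _ _ H) as [(b & Hs & Hb)|(t & b & Ht1 & Hs & Hm & Hb1 & Hb2)].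
- destruct (advance _ _ _ _ b H Hs Hb) as (p1 & e1 & H1 & _ & _ & L1).
  specialize (L1 (m + 4)%nat); replace (S (m + 4)) with (m + 5)%nat in L1 by lia.
  eapply Rle_trans; [exact L1|].
  eapply Rle_trans; [apply (IH (m + 4)%nat ltac:(lia) _ _ _ _ H1)|].
  rewrite !Rmult_assoc; apply Rmult_le_compat_l; [lra|]; apply Rmult_le_compat_l; [lra|].
  nra.
- assert (Hc : ends (fun z => 0 <= snd z) p e).
  { destruct H as ((T1 & T2 & T3) & (T1' & T2' & T3') & _); split; nra. }
  destruct (cut _ _ _ _ _ _ _ H Hs Ht1 Hm Hb1 Hb2 Hc)
    as (s1 & p1 & e1 & s2 & p2 & e2 & H1 & H2 & N1 & N2 & L).
  specialize (L (m + 4)%nat); replace (S (m + 4)) with (m + 5)%nat in L by lia.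
  eapply Rle_trans; [exact L|].
  destruct (Rle_dec (1 / 100) nu) as [Hl|Hl].
  (* The cut costs [2 - kap], at most [67 / 100]; for [1 / 100 <= nu] the gain
     [30000 * (kap - rho) * nu] is at least [79 / 100]. *)
  + eapply Rle_trans; [apply Rplus_le_compat; eapply IH; eauto; lia|].
    replace (16 * kap ^ (m + 4) * (1 + 30000 * (rho * (t * nu))) +
      16 * kap ^ (m + 4) * (1 + 30000 * (rho * ((1 - t) * nu))))
      with (16 * kap ^ (m + 4) * (2 + 30000 * (rho * nu))) by ring.
    rewrite !Rmult_assoc; apply Rmult_le_compat_l; [lra|]; apply Rmult_le_compat_l; [lra|].
    nra.
  + assert (B : forall r, 0 <= r <= 1 -> rho * (r * nu) <= 2 / 100).
    { intros r Hr1; assert (r * nu <= 1 / 100) by nra.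
      assert (0 <= r * nu) by (apply Rmult_le_pos; lra).
      apply Rle_trans with (144 / 100 * (1 / 100)); [apply Rmult_le_compat; lra|lra]. }
    assert (E : forall p e, ends (fun z => 0 <= fst z /\ 1 - 2 * nu <= snd z) p e ->
      ends (fun z => 98 / 100 <= snd z) p e) by (intros ? ? []; split; lra).
    assert (IH' : forall k s p e nu, (k < m + 5)%nat -> St s p e nu ->
      laps (seg p e) k <= 16 * kap ^ k * (1 + 30000 * nu)) by (intros; eapply IH; eauto).
    generalize (laps_near_top m IH' _ _ _ _ H1 ltac:(apply B; lra) (E _ _ N1))
      (laps_near_top m IH' _ _ _ _ H2 ltac:(apply B; lra) (E _ _ N2)); intros Q1 Q2.
    eapply Rle_trans; [apply Rplus_le_compat; [exact Q1|exact Q2]|].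
    replace (16 * kap ^ (m + 4) * (kap / 2 + 30000 * (rho * (t * nu))) +
        16 * kap ^ (m + 4) * (kap / 2 + 30000 * (rho * ((1 - t) * nu))))
        with (16 * kap ^ (m + 4) * (kap + 30000 * (rho * nu))) by field.
    rewrite !Rmult_assoc; apply Rmult_le_compat_l; [lra|]; apply Rmult_le_compat_l; [lra|].
    nra.
Qed.

(** * Boundedness of the densities *)

(** [npre n z / jac ^ n] is the density at [z] of the [n]-th image of Lebesgue measure on [trap]. *)
Fixpoint npre (n : nat) (z : R * R) : R :=
  match n with
  | O => indic (trap z)
  | S m => if Rlt_dec (snd z) 1 then npre m (h true z) + npre m (h false z) else 0
  end.

(** The point avoids the full lines that carry the first [M + 1] images of the fold line, not only
    the pieces that the dynamics produces. *)
Fixpoint generic (M : nat) (z : R * R) : Prop :=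
  snd z <> 1 /\ match M with O => True | S m => generic m (h true z) /\ generic m (h false z) end.

Definition top : set2 := seg (0, 1) (1, 0).

Definition trap_bd : set2 := fun z =>
  (seg (0, 2 * al) (0, 1 - 2 * al) z \/ seg (1, 0) (0, 1) z) \/
  (top z \/ seg (0, 2 * al) (1, - (2 * al)) z).

(** Crossings are counted by words rather than by points, so that [laps] bounds them. *)
Definition meet (X : set2) (n : nat) (z z' : R * R) : R :=
  count_words n (fun v => exists t, 0 <= t <= 1 /\ img X v (pt z (delta z z') t)).

Lemma npre_ge0 n : forall z, 0 <= npre n z.
Proof.
induction n as [|n IH]; intros z; simpl; [apply indic_bounds|].
destruct (Rlt_dec (snd z) 1); [|lra].
generalize (IH (h true z)) (IH (h false z)); lra.
Qed.

Lemma trap_h b z : snd z < 1 -> trap (h b z) -> trap z.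
Proof.
intros H1 H2; rewrite <- (g_h b z); apply trap_g; auto.
rewrite <- (g_h b z), snd_g_lt in H1; destruct b; unfold on; lra.
Qed.

Lemma npre_supp n : forall z, ~ trap z -> npre n z = 0.
Proof.
induction n as [|n IH]; intros z Hz; simpl; [apply indic_false; auto|].
destruct (Rlt_dec (snd z) 1) as [H|H]; auto.
rewrite !IH; try lra; intros K; apply Hz; eapply trap_h; eauto.
Qed.

Lemma meet_le_lam X n z z' : meet X n z z' <= laps X n.
Proof. apply count_words_mono; intros v _ (t & _ & H); eauto. Qed.

Lemma meet_ge0 X n z z' : 0 <= meet X n z z'.
Proof. apply count_words_ge0. Qed.

Lemma pt_pt z z' r t : pt z (delta z (pt z (delta z z') r)) t = pt z (delta z z') (r * t).
Proof. destruct z, z'; unfold pt, delta; simpl; f_equal; ring. Qed.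

(** Each crossing of a piece of order [n] by one of the two lifts lies over a crossing of a piece of
    order [S n]; [img] admits it only below height 1. *)
Lemma meet_S X n z z' r : 0 <= r <= 1 ->
  (forall t, 0 <= t <= r -> snd (pt z (delta z z') t) < 1) ->
  meet X n (h true z) (h true (pt z (delta z z') r)) +
  meet X n (h false z) (h false (pt z (delta z z') r)) <= meet X (S n) z z'.
Proof.
intros Hr H; unfold meet; simpl.
apply Rplus_le_compat; apply count_words_mono; intros v _ (t & Ht & Hv); exists (r * t);
  rewrite <- h_delta, pt_pt in Hv; (split; [nra|split; [apply H; nra|exact Hv]]).
Qed.

(** The affine function has at most one zero, and one of the two open halves of the interval misses
    it. *)
Lemma avoid c0 c1 a b : c0 <> 0 -> a < b -> exists a' b', a <= a' < b' /\ b' <= b /\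
  forall t, a' < t < b' -> c0 + t * c1 <> 0.
Proof.
intros Hc Hab.
destruct (Req_dec c1 0) as [->|H1].
{ exists a, b; repeat split; try lra; intros; lra. }
assert (E : forall t, c0 + t * c1 = 0 -> t = - c0 / c1).
{ intros t Ht; apply Rmult_eq_reg_r with c1; auto; field_simplify; lra. }
destruct (Rle_dec (- c0 / c1) ((a + b) / 2)).
- exists ((a + b) / 2), b; repeat split; try lra; intros t Ht K; apply E in K; lra.
- exists a, ((a + b) / 2); repeat split; try lra; intros t Ht K; apply E in K; lra.
Qed.

(** Supplies a generic point of the segment before it reaches height 1, where bounds on earlier
    densities apply. *)
Lemma generic_line M : forall z z' a b, generic M z -> a < b -> exists a' b', a <= a' < b' /\ b' <= b /\
  forall t, a' < t < b' -> generic M (pt z (delta z z') t).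
Proof.
induction M as [|M IH]; intros z z' a b [H HM] Hab;
  (destruct (avoid (snd z - 1) (snd z' - snd z) a b ltac:(lra) Hab) as (a1 & b1 & H1 & H2 & H3)).
- exists a1, b1; repeat split; try lra.
  unfold pt, delta; simpl; specialize (H3 t ltac:(lra)); lra.
- destruct HM as [HM1 HM2].
  destruct (IH _ (h true z') a1 b1 HM1 ltac:(lra)) as (a2 & b2 & K1 & K2 & K3).
  destruct (IH _ (h false z') a2 b2 HM2 ltac:(lra)) as (a3 & b3 & L1 & L2 & L3).
  exists a3, b3; split; [lra|split; [lra|]]; intros t Ht; simpl; rewrite !h_delta.
  split; [|split; [apply K3; lra | apply L3; lra]].
  unfold pt, delta; simpl; specialize (H3 t ltac:(lra)); lra.
Qed.

(** [t] is the last parameter up to which all the affine functions [fst f + t * snd f] are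
    nonnegative: a new function either changes nothing or moves [t] back to its own zero. *)
Lemma clip (l : list (R * R)) : (forall f, In f l -> 0 <= fst f) ->
  exists t, 0 <= t <= 1 /\ (forall f, In f l -> 0 <= fst f + t * snd f) /\
    (t = 1 \/ exists f, In f l /\ fst f + t * snd f = 0).
Proof.
induction l as [|f l IH]; intros H.
{ exists 1; split; [lra|split; [intros f []|auto]]. }
destruct IH as (t & Ht & Hl & Hz); [intros; apply H; simpl; auto|].
destruct (Rle_dec 0 (fst f + t * snd f)) as [Hf|Hf].
{ exists t; split; [auto|split].
  - intros f' [<-|Hf']; auto.
  - destruct Hz as [Hz|(f' & Hf' & E)]; auto; right; exists f'; simpl; auto. }
assert (H0 : 0 <= fst f) by (apply H; simpl; auto).
assert (Hs : snd f < 0) by nra.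
exists (fst f / - snd f).
assert (E : fst f / - snd f * - snd f = fst f) by (field; lra).
assert (B : 0 <= fst f / - snd f <= t).
{ split; [apply Rle_mult_inv_pos; lra|]; apply Rmult_le_reg_r with (- snd f); lra. }
split; [lra|split].
- intros f' [<-|Hf']; [lra|].
  specialize (Hl f' Hf'); assert (0 <= fst f') by (apply H; simpl; auto).
  set (s := fst f / - snd f) in *.
  destruct (Rle_dec 0 (snd f')); [nra|].
  apply Rle_trans with (fst f' + t * snd f'); nra.
- right; exists f; split; [simpl; auto|lra].
Qed.

(** [clip] is applied to the four inequalities that define [trap]; the one that becomes an equality
    tells the side. *)
Lemma trap_exit z z' : trap z -> ~ trap z' -> exists t, 0 <= t <= 1 /\ trap_bd (pt z (delta z z') t).
Proof.
intros Hz Hz'.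
destruct (clip ((fst z, fst z' - fst z) :: (1 - fst z, fst z - fst z') ::
  (1 - snd z, snd z - snd z') ::
  (snd z - 2 * al * (1 - fst z), (snd z' - snd z) + 2 * al * (fst z' - fst z)) :: nil))
  as (t & Ht & Hall & Hone).
{ destruct Hz as (H1 & H2 & H3).
  intros f Hf; repeat (destruct Hf as [<-|Hf]; [simpl; lra|]); destruct Hf. }
exists t; split; auto.
assert (B1 := Hall _ (or_introl eq_refl)).
assert (B2 := Hall _ (or_intror (or_introl eq_refl))).
assert (B3 := Hall _ (or_intror (or_intror (or_introl eq_refl)))).
assert (B4 := Hall _ (or_intror (or_intror (or_intror (or_introl eq_refl))))).
simpl in B1, B2, B3, B4.
destruct Hone as [->|(f & Hf & E)].
{ exfalso; apply Hz'; unfold trap; lra. }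
unfold trap_bd, top, seg.
set (x := fst z + t * (fst z' - fst z)) in *; set (y := snd z + t * (snd z' - snd z)).
assert (Ez : pt z (delta z z') t = (x, y)) by reflexivity.
rewrite Ez.
assert (B3' : y <= 1) by (unfold y; lra).
assert (B4' : 2 * al * (1 - x) <= y) by (unfold x, y; lra).
assert (B2' : x <= 1) by (unfold x; lra).
assert (0 <= al * (1 - x)) by (apply Rmult_le_pos; lra).
destruct Hf as [<-|[<-|[<-|[<-|[]]]]]; simpl in E.
- left; left; exists ((y - 2 * al) / (1 - 2 * al)).
  fold x in E; assert (Ex : x = 0) by lra; rewrite Ex in *.
  split; [split; [apply Rle_mult_inv_pos; lra|]|].
  + apply Rmult_le_reg_r with (1 - 2 * al); [lra|].
    replace ((y - 2 * al) / (1 - 2 * al) * (1 - 2 * al)) with (y - 2 * al) by (field; lra); lra.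
  + unfold pt; simpl; f_equal; field; lra.
- left; right; exists y.
  assert (Ex : x = 1) by (unfold x; lra); rewrite Ex in *.
  split; [lra|unfold pt; simpl; f_equal; ring].
- right; left; exists x; assert (Ey : y = 1) by (unfold y; lra); rewrite Ey.
  split; [lra|unfold pt; simpl; f_equal; ring].
- right; right; exists x; assert (Ey : y = 2 * al * (1 - x)) by (unfold x, y; lra); rewrite Ey.
  split; [lra|unfold pt; simpl; f_equal; ring].
Qed.

(** Peeled at index 0: in [npre_diff] that term is a crossing of [top] itself, and the others come
    from one backward step. *)
Fixpoint sumh (n : nat) (f : nat -> R) : R :=
  match n with O => 0 | S k => f O + sumh k (fun j => f (S j)) end.

Lemma sumh_le n : forall f f', (forall j, (j < n)%nat -> f j <= f' j) -> sumh n f <= sumh n f'.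
Proof.
induction n as [|n IH]; intros f f' H; simpl; [lra|].
apply Rplus_le_compat; [apply H; lia|apply IH; intros; apply H; lia].
Qed.

Lemma sumh_plus n : forall f f', sumh n (fun j => f j + f' j) = sumh n f + sumh n f'.
Proof. induction n as [|n IH]; intros f f'; simpl; [lra|rewrite IH; lra]. Qed.

Lemma sumh_scal n c : forall f, sumh n (fun j => c * f j) = c * sumh n f.
Proof. induction n as [|n IH]; intros f; simpl; [lra|rewrite IH; lra]. Qed.

(** The lifts of the segment [z, z'] to the [n]-th preimages of [z] end at preimages of [z'], except
    those that run into the fold line, or start outside [trap]. *)
Lemma npre_diff J M n : 0 <= M ->
  (forall m z, (m < n)%nat -> generic (m + J) z -> npre m z <= M * jac ^ m) ->
  forall z z', generic (n + J) z ->
  npre n z <= npre n z' + sumh n (fun j => 2 * meet top j z z' * (M * jac ^ (n - S j))) + meet trap_bd n z z'.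
Proof.
intros HM; induction n as [|n IH]; intros Hlt z z' HG.
{ simpl; rewrite Rplus_0_r.
  destruct (excluded_middle_informative (trap z)) as [Hz|Hz].
  2:{ rewrite (indic_false _ Hz); generalize (indic_bounds (trap z')) (meet_ge0 trap_bd 0 z z'); lra. }
  destruct (excluded_middle_informative (trap z')) as [Hz'|Hz'].
  - rewrite !indic_true by auto; generalize (meet_ge0 trap_bd 0 z z'); lra.
  - rewrite (indic_true (trap z)), (indic_false (trap z')) by auto.
    unfold meet, count_words; rewrite indic_true; [lra|]; apply trap_exit; auto. }
assert (Hdd : forall k, 0 < jac ^ k) by (intros; apply pow_lt; generalize jac_bounds; lra).
assert (Hrest : 0 <= sumh (S n) (fun j => 2 * meet top j z z' * (M * jac ^ (S n - S j)))
  + meet trap_bd (S n) z z').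
{ assert (sumh (S n) (fun j => 0 * 0) <=
    sumh (S n) (fun j => 2 * meet top j z z' * (M * jac ^ (S n - S j)))).
  { apply sumh_le; intros; rewrite Rmult_0_l; apply Rmult_le_pos; [|apply Rmult_le_pos; auto; left; auto].
    generalize (meet_ge0 top j z z'); lra. }
  rewrite sumh_scal in H; generalize (meet_ge0 trap_bd (S n) z z'); lra. }
destruct (Rlt_dec (snd z) 1) as [Hz|Hz].
2:{ simpl npre at 1; destruct (Rlt_dec (snd z) 1); [lra|].
    generalize (npre_ge0 (S n) z'); lra. }
destruct HG as [HG0 [HG1 HG2]].
assert (Hlt' : forall m z, (m < n)%nat -> generic (m + J) z -> npre m z <= M * jac ^ m) by auto.
(* As long as the segment stays below height 1, both its lifts exist; the induction hypothesis holds
   for each, and [meet_S] adds up their crossings. *)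
assert (Step : forall r, 0 <= r <= 1 -> (forall t, 0 <= t <= r -> snd (pt z (delta z z') t) < 1) ->
  npre (S n) z <= npre n (h true (pt z (delta z z') r)) + npre n (h false (pt z (delta z z') r))
    + sumh n (fun j => 2 * meet top (S j) z z' * (M * jac ^ (n - S j))) + meet trap_bd (S n) z z').
{ intros r Hr Hs; set (w := pt z (delta z z') r).
  generalize (IH Hlt' _ (h true w) HG1) (IH Hlt' _ (h false w) HG2) (meet_S trap_bd n z z' r Hr Hs).
  fold w; intros I1 I2 I3.
  assert (I4 : sumh n (fun j => 2 * meet top j (h true z) (h true w) * (M * jac ^ (n - S j)))
    + sumh n (fun j => 2 * meet top j (h false z) (h false w) * (M * jac ^ (n - S j)))
    <= sumh n (fun j => 2 * meet top (S j) z z' * (M * jac ^ (n - S j)))).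
  { rewrite <- sumh_plus; apply sumh_le; intros j _.
    generalize (meet_S top j z z' r Hr Hs); fold w; intros I4.
    rewrite <- Rmult_plus_distr_r; apply Rmult_le_compat_r; [|lra].
    apply Rmult_le_pos; auto; left; auto. }
  simpl npre at 1; destruct (Rlt_dec (snd z) 1); [lra|tauto]. }
change (sumh (S n) (fun j => 2 * meet top j z z' * (M * jac ^ (S n - S j)))) with
  (2 * meet top 0 z z' * (M * jac ^ (S n - 1)) +
   sumh n (fun j => 2 * meet top (S j) z z' * (M * jac ^ (n - S j)))).
replace (S n - 1)%nat with n by lia.
assert (Htop0 : 0 <= 2 * meet top 0 z z' * (M * jac ^ n)).
{ apply Rmult_le_pos; [generalize (meet_ge0 top 0 z z'); lra|apply Rmult_le_pos; auto; left; auto]. }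
assert (Hsnd : forall t, snd (pt z (delta z z') t) = snd z + t * (snd z' - snd z)) by reflexivity.
destruct (Rlt_dec (snd z') 1) as [Hz'|Hz'].
{ generalize (Step 1 ltac:(lra)); rewrite pt_delta; intros Q; simpl npre at 2.
  destruct (Rlt_dec (snd z') 1); [|tauto].
  eapply Rle_trans; [apply Q|lra].
  intros t Ht; rewrite Hsnd; destruct (Rle_dec (snd z) (snd z')); nra. }
set (t0 := (1 - snd z) / (snd z' - snd z)).
assert (Et0 : t0 * (snd z' - snd z) = 1 - snd z) by (unfold t0; field; lra).
assert (Ht0 : 0 < t0 <= 1).
{ split; [apply Rdiv_lt_0_compat; lra|].
  apply Rmult_le_reg_r with (snd z' - snd z); [lra|rewrite Et0; lra]. }
assert (Hbefore : forall t, 0 <= t -> t < t0 -> snd (pt z (delta z z') t) < 1).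
{ intros t H1 H2; rewrite Hsnd; nra. }
generalize (npre_ge0 (S n) z'); intros Hpc'.
(* If the segment reaches height 1 on the top side, the two preimages of an earlier generic point
   carry at most [M * jac ^ n] each, which the term of index 0 pays for. Otherwise it has left
   [trap] before, and the density vanishes there. *)
destruct (excluded_middle_informative (top (pt z (delta z z') t0))) as [Ht|Ht].
- destruct (generic_line (S n + J) z z' 0 t0 (conj HG0 (conj HG1 HG2)) ltac:(lra))
    as (a & b & Ha & Hb & Hab).
  specialize (Hab ((a + b) / 2) ltac:(lra)).
  specialize (Step ((a + b) / 2) ltac:(lra) ltac:(intros; apply Hbefore; lra)).
  set (w := pt z (delta z z') ((a + b) / 2)) in *.
  destruct Hab as [_ [Hw1 Hw2]].
  generalize (Hlt n (h true w) ltac:(lia) Hw1) (Hlt n (h false w) ltac:(lia) Hw2); intros B1 B2.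
  assert (E1 : meet top 0 z z' = 1).
  { unfold meet, count_words; apply indic_true; exists t0; split; [lra|exact Ht]. }
  rewrite E1; lra.
- assert (Hx : fst (pt z (delta z z') t0) < 0 \/ 1 < fst (pt z (delta z z') t0)).
  { apply NNPP; intros K; apply Ht; exists (fst (pt z (delta z z') t0)); split; [lra|].
    assert (Eq : snd (pt z (delta z z') t0) = 1) by (rewrite Hsnd; lra).
    destruct (pt z (delta z z') t0) as [x y]; simpl in Eq; subst y.
    unfold pt; simpl; f_equal; ring. }
  assert (Hr : exists r, 0 <= r < t0 /\ ~ trap (pt z (delta z z') r)).
  { set (k := fst z' - fst z).
    assert (Ef : forall t, fst (pt z (delta z z') t) = fst z + t * k) by reflexivity.
    rewrite !Ef in Hx.
    (* [eta] is the distance from the abscissa of the crossing to [[0, 1]]; going back by [s]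
       changes the abscissa by less than that. *)
    set (eta := Rmax (- (fst z + t0 * k)) (fst z + t0 * k - 1)).
    assert (He : 0 < eta).
    { unfold eta; destruct Hx; [eapply Rlt_le_trans; [|apply Rmax_l]|eapply Rlt_le_trans; [|apply Rmax_r]]; lra. }
    set (s := Rmin t0 (eta / (2 * (Rabs k + 1)))).
    assert (Hk : 0 <= Rabs k) by apply Rabs_pos.
    assert (Hs : 0 < s) by (apply Rmin_glb_lt; [lra|apply Rdiv_lt_0_compat; lra]).
    assert (Hs1 : s <= t0) by apply Rmin_l.
    assert (Hs2 : s * Rabs k < eta).
    { apply Rle_lt_trans with (eta / (2 * (Rabs k + 1)) * Rabs k).
      - apply Rmult_le_compat_r; auto; apply Rmin_r.
      - apply Rmult_lt_reg_r with (2 * (Rabs k + 1)); [lra|].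
        replace (eta / (2 * (Rabs k + 1)) * Rabs k * (2 * (Rabs k + 1))) with (eta * Rabs k)
          by (field; lra). nra. }
    exists (t0 - s); split; [lra|]; intros [K _]; rewrite Ef in K.
    assert (A1 : s * k <= s * Rabs k) by (apply Rmult_le_compat_l; [lra|apply Rle_abs]).
    assert (A2 : - (s * k) <= s * Rabs k).
    { rewrite Ropp_mult_distr_r.
      apply Rmult_le_compat_l; [lra|]; rewrite <- Rabs_Ropp; apply Rle_abs. }
    unfold eta in Hs2; revert Hs2; unfold Rmax.
    destruct (Rle_dec (- (fst z + t0 * k)) (fst z + t0 * k - 1)); lra. }
  destruct Hr as (r & Hr & HrT).
  specialize (Step r ltac:(lra) ltac:(intros; apply Hbefore; lra)).
  assert (E0 : npre n (h true (pt z (delta z z') r)) + npre n (h false (pt z (delta z z') r)) = 0).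
  { generalize (npre_supp (S n) _ HrT); simpl.
    destruct (Rlt_dec (snd z + r * (snd z' - snd z)) 1) as [H1|H1]; auto.
    exfalso; apply H1, (Hbefore r); lra. }
  lra.
Qed.

(** * Finite arrangements of lines *)

Definition aff_eval (f : R * R * R) (z : R * R) : R := fst (fst f) * fst z + snd (fst f) * snd z + snd f.

(** The pullback by [h b] of the affine function with coefficients [f]. *)
Definition aff_h (b : bool) (f : R * R * R) : R * R * R :=
  let '(p, q, r) := f in
  if b then (q - p * al / (1 - al), p / (2 * (1 - al)), r)
  else (q - p * al / (1 - al), - (p / (2 * (1 - al))), p / (1 - al) + r).

Lemma aff_eval_aff_h b f z : aff_eval (aff_h b f) z = aff_eval f (h b z).
Proof.
destruct f as [[p q] r], z as [x y], b; unfold aff_eval, aff_h, h; simpl; field; lra.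
Qed.

(** Equations of the lines that carry the first [J + 1] images of the fold line. *)
Fixpoint walls (J : nat) : list (R * R * R) :=
  (0, 1, -1) :: match J with
  | O => nil
  | S k => map (aff_h true) (walls k) ++ map (aff_h false) (walls k)
  end.

Lemma walls_head J : In (0, 1, -1) (walls J).
Proof. destruct J; left; reflexivity. Qed.

Lemma walls_generic J : forall z f, generic J z -> In f (walls J) -> aff_eval f z <> 0.
Proof.
induction J as [|J IH]; intros z f [H HJ] Hf.
- destruct Hf as [<-|[]]; unfold aff_eval; simpl; lra.
- destruct HJ as [H1 H2]; destruct Hf as [<-|Hf]; [unfold aff_eval; simpl; lra|].
  apply in_app_iff in Hf; destruct Hf as [Hf|Hf]; apply in_map_iff in Hf;
    destruct Hf as (f' & <- & Hf); rewrite aff_eval_aff_h; auto.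
Qed.

Lemma img_top_wall J : forall v z, (length v <= J)%nat -> img top v z ->
  exists f, In f (walls J) /\ aff_eval f z = 0.
Proof.
induction J as [|J IH]; intros [|b v] z Hv Hz; simpl in Hv; try lia.
- exists (0, 1, -1); split; [apply walls_head|].
  destruct Hz as (t & _ & ->); unfold aff_eval, pt; simpl; ring.
- exists (0, 1, -1); split; [apply walls_head|].
  destruct Hz as (t & _ & ->); unfold aff_eval, pt; simpl; ring.
- destruct Hz as [_ Hz]; destruct (IH v (h b z) ltac:(lia) Hz) as (f & Hf & E).
  exists (aff_h b f); rewrite aff_eval_aff_h; split; auto.
  right; apply in_app_iff; destruct b; [left|right]; apply in_map; auto.
Qed.

Definition square (c : R * R) (de : R) : set2 := open_rect (fst c) (fst c + de) (snd c) (snd c + de).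

Lemma square_sub c de de' z : de <= de' -> square c de z -> square c de' z.
Proof. unfold square, open_rect; lra. Qed.

Lemma open_signs (l : list (R * R * R)) z : (forall f, In f l -> 0 < aff_eval f z) ->
  exists de, 0 < de /\ forall z', square z de z' -> forall f, In f l -> 0 < aff_eval f z'.
Proof.
induction l as [|f l IH]; intros H.
{ exists 1; split; [lra|intros z' _ f []]. }
destruct IH as (d1 & Hd1 & H1); [intros; apply H; simpl; auto|].
destruct f as [[p q] r]; set (f := (p, q, r)) in *.
assert (Hf : 0 < aff_eval f z) by (apply H; simpl; auto).
assert (Hp := Rabs_pos p); assert (Hq := Rabs_pos q).
(* On a square of side [d2], [f] drops by at most [(Rabs p + Rabs q) * d2], less than its value at
   [z]. *)
set (d2 := aff_eval f z / (Rabs p + Rabs q + 1)).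
assert (Hd2 : 0 < d2) by (apply Rdiv_lt_0_compat; lra).
assert (E2 : d2 * (Rabs p + Rabs q + 1) = aff_eval f z) by (unfold d2; field; lra).
exists (Rmin d1 d2); split; [apply Rmin_glb_lt; auto|].
intros z' Hz' f' [<-|Hf'].
2:{ apply H1; auto; eapply square_sub; [apply Rmin_l|exact Hz']. }
apply (square_sub _ _ d2) in Hz'; [|apply Rmin_r].
destruct z as [x y], z' as [x' y']; unfold square, open_rect in Hz'; unfold f, aff_eval in *; simpl in *.
assert (- Rabs p <= p) by (rewrite <- Rabs_Ropp; generalize (Rle_abs (- p)); lra).
assert (- Rabs q <= q) by (rewrite <- Rabs_Ropp; generalize (Rle_abs (- q)); lra).
assert (- Rabs p * d2 <= p * (x' - x)) by nra.
assert (- Rabs q * d2 <= q * (y' - y)) by nra.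
lra.
Qed.

(** [de] does not depend on [z] because there are finitely many sign patterns: [acc] collects one
    sign by sign, both signs are explored and the smaller size is kept. At the leaves a sample point
    of the face, if there is one, gives the square. *)
Lemma faces (l : list (R * R * R)) : forall acc, exists de, 0 < de /\
  forall z, (forall f, In f acc -> 0 < aff_eval f z) -> (forall f, In f l -> aff_eval f z <> 0) ->
  exists c, forall z', square c de z' ->
    (forall f, In f acc -> 0 < aff_eval f z') /\ (forall f, In f l -> 0 < aff_eval f z * aff_eval f z').
Proof.
induction l as [|f l IH]; intros acc.
- destruct (excluded_middle_informative (exists z, forall f, In f acc -> 0 < aff_eval f z)) as [[z0 H0]|H0].
  + destruct (open_signs acc z0 H0) as (de & Hde & H).
    exists de; split; auto; intros z _ _; exists z0; intros z' Hz'; split; [auto|intros f []].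
  + exists 1; split; [lra|]; intros z Hz _; exfalso; eauto.
- destruct f as [[p q] r]; set (f := (p, q, r)).
  set (f' := (- p, - q, - r)).
  assert (Ef : forall z, aff_eval f' z = - aff_eval f z) by (intros; unfold f', f, aff_eval; simpl; ring).
  destruct (IH (f :: acc)) as (d1 & Hd1 & H1), (IH (f' :: acc)) as (d2 & Hd2 & H2).
  exists (Rmin d1 d2); split; [apply Rmin_glb_lt; auto|].
  intros z Hacc Hl.
  assert (Hf : aff_eval f z <> 0) by (apply Hl; simpl; auto).
  destruct (Rlt_dec 0 (aff_eval f z)) as [Hp|Hp].
  + destruct (H1 z) as [c Hc].
    { intros f0 [<-|Hf0]; auto. }
    { intros; apply Hl; simpl; auto. }
    exists c; intros z' Hz'; destruct (Hc z') as [K1 K2].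
    { eapply square_sub; [apply Rmin_l|exact Hz']. }
    split; [intros; apply K1; simpl; auto|].
    intros f0 [<-|Hf0]; auto; apply Rmult_lt_0_compat; auto; apply K1; simpl; auto.
  + destruct (H2 z) as [c Hc].
    { intros f0 [<-|Hf0]; auto; rewrite Ef; lra. }
    { intros; apply Hl; simpl; auto. }
    exists c; intros z' Hz'; destruct (Hc z') as [K1 K2].
    { eapply square_sub; [apply Rmin_r|exact Hz']. }
    split; [intros; apply K1; simpl; auto|].
    intros f0 [<-|Hf0]; auto.
    specialize (K1 f' (or_introl eq_refl)); rewrite Ef in K1; fold f; nra.
Qed.

Lemma aff_eval_pt f z z' t : aff_eval f (pt z (delta z z') t) = (1 - t) * aff_eval f z + t * aff_eval f z'.
Proof. destruct f as [[p q] r], z, z'; unfold aff_eval, pt, delta; simpl; ring. Qed.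

(** An affine function with the same strict sign at both ends of a segment has no zero on it, so a
    segment within a face crosses no wall. *)
Lemma meet_top_0 J : exists de, 0 < de /\ forall z, generic J z -> exists c, forall z', square c de z' ->
  forall j, (j <= J)%nat -> meet top j z z' = 0.
Proof.
destruct (faces (walls J) nil) as (de & Hde & H); exists de; split; auto.
intros z Hz; destruct (H z) as [c Hc]; [intros f []|intros f; apply walls_generic; auto|].
exists c; intros z' Hz' j Hj; apply count_words_empty; intros v Hv (t & Ht & Hi).
destruct (img_top_wall J v _ ltac:(lia) Hi) as (f & Hf & E).
destruct (Hc z' Hz') as [_ K]; specialize (K f Hf); rewrite aff_eval_pt in E.
set (a := aff_eval f z) in *; set (b := aff_eval f z') in *.
assert (Ha : 0 < a * a) by (apply Rsqr_pos_lt; nra).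
assert (E' : (1 - t) * (a * a) + t * (a * b) = 0).
{ replace ((1 - t) * (a * a) + t * (a * b)) with (a * ((1 - t) * a + t * b)) by ring.
  rewrite E; ring. }
destruct (Rle_dec t (1 / 2)); nra.
Qed.

Lemma img_or v (X Y : set2) : forall z, img (fun y => X y \/ Y y) v z -> img X v z \/ img Y v z.
Proof.
induction v as [|b v IH]; simpl; auto.
intros z [H1 H2]; destruct (IH _ H2); auto.
Qed.

Lemma laps_or n (X Y : set2) : laps (fun z => X z \/ Y z) n <= laps X n + laps Y n.
Proof.
eapply Rle_trans; [|apply count_words_or]; apply count_words_mono.
intros v _ [z Hz]; destruct (img_or _ _ _ _ Hz); [left|right]; exists z; auto.
Qed.

(** State [SA] asks nothing about the past, so any segment of [trap] may start in it; [10] bounds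
    the norms of all four sides. *)
Lemma laps_side p e n : trap p -> trap (pt p e 1) -> qform SA e <= 10 ^ 2 ->
  laps (seg p e) n <= 16 * kap ^ n * (1 + 30000 * 10).
Proof. intros; apply (laps_segment n SA); unfold St, pre; repeat split; try lra; apply H || apply H0. Qed.

Lemma laps_top n : laps top n <= 16 * kap ^ n * (1 + 30000 * 10).
Proof. apply laps_side; unfold trap, pt; simpl; lra. Qed.

Lemma laps_trap_bd n : laps trap_bd n <= 4 * (16 * kap ^ n * (1 + 30000 * 10)).
Proof.
unfold trap_bd.
eapply Rle_trans; [apply laps_or|].
eapply Rle_trans; [apply Rplus_le_compat; apply laps_or|].
generalize (laps_top n).
assert (H1 := laps_side (0, 2 * al) (0, 1 - 2 * al) n).
assert (H2 := laps_side (1, 0) (0, 1) n).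
assert (H3 := laps_side (0, 2 * al) (1, - (2 * al)) n).
unfold trap, pt in *; simpl in H1, H2, H3.
specialize (H1 ltac:(lra) ltac:(lra) ltac:(nra)).
specialize (H2 ltac:(lra) ltac:(lra) ltac:(nra)).
specialize (H3 ltac:(lra) ltac:(lra) ltac:(nra)).
change (fun z => top z) with top; lra.
Qed.

Lemma sumh_geom r n : 0 <= r < 1 -> sumh n (fun j => r ^ j) <= 1 / (1 - r).
Proof.
intros Hr; induction n as [|n IH]; simpl.
- apply Rle_mult_inv_pos; lra.
- rewrite sumh_scal.
  replace (1 / (1 - r)) with (1 + r * (1 / (1 - r))) by (field; lra).
  apply Rplus_le_compat_l, Rmult_le_compat_l; [lra|exact IH].
Qed.

Lemma sumh_geom_tail r J : 0 <= r < 1 -> forall n,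
  sumh n (fun j => if Compare_dec.le_lt_dec j J then 0 else r ^ j) <= r ^ J * (1 / (1 - r)).
Proof.
intros Hr.
assert (Hpos : forall k, 0 <= r ^ k * (1 / (1 - r))).
{ intros; apply Rmult_le_pos; [apply pow_le; lra|apply Rle_mult_inv_pos; lra]. }
induction J as [|J IH]; intros [|n]; try (apply Hpos); cbn [sumh];
  destruct (Compare_dec.le_lt_dec 0 _) as [_|K]; try lia; rewrite Rplus_0_l.
- eapply Rle_trans with (sumh n (fun j => r * r ^ j)).
  + apply sumh_le; intros j _; destruct (Compare_dec.le_lt_dec (S j) 0); [lia|simpl; lra].
  + rewrite sumh_scal; generalize (sumh_geom r n Hr) (Hpos O); simpl pow.
    intros H1 H2; eapply Rle_trans; [apply Rmult_le_compat_l; [lra|exact H1]|].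
    apply Rmult_le_compat_r; lra.
- eapply Rle_trans with
    (sumh n (fun j => r * (if Compare_dec.le_lt_dec j J then 0 else r ^ j))).
  + apply sumh_le; intros j _; destruct (Compare_dec.le_lt_dec (S j) (S J)),
      (Compare_dec.le_lt_dec j J); try lia; simpl; lra.
  + rewrite sumh_scal; simpl; rewrite Rmult_assoc; apply Rmult_le_compat_l; [lra|apply IH].
Qed.

(** Within a face of the arrangement of the walls of order at most [J] only the walls of higher order
    are crossed, and there are at most [O(kap ^ j)] of them of order [j], each of height
    [O(jac ^ (n - j))]. *)
Theorem npre_bounded :
  (forall n c de, 0 < de -> exists z', square c de z' /\ npre n z' * de ^ 2 <= 2 * jac ^ n) ->
  exists M J, 0 < M /\ forall n z, generic (n + J) z -> npre n z <= M * jac ^ n.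
Proof.
intros Havg.
assert (Hdd := jac_bounds).
set (C := 16 * (1 + 30000 * 10)).
set (r := 998 / 1000).
(* The tail beyond [J] is at most [500 * r ^ J], and this choice makes [2 * C] times it at most
   [1 / 2]. *)
destruct (pow_lt_1_zero r) with (y := 1 / (2000 * C)) as [J HJ].
{ unfold r; rewrite Rabs_right; lra. }
{ unfold C; lra. }
specialize (HJ J (le_n J)).
rewrite Rabs_right in HJ by (apply Rle_ge, pow_le; unfold r; lra).
destruct (meet_top_0 J) as (de & Hde & Hface).
(* Solves [M = M / 2 + 2 / de ^ 2 + 4 * C], whose terms come from the walls of high order, the
   average over the square and the boundary of [trap]. *)
set (M := 2 * (2 / de ^ 2 + 4 * C)).
assert (Hde2 : 0 < de ^ 2) by (apply pow_lt; auto).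
assert (HM1 : 0 < 2 / de ^ 2) by (apply Rdiv_lt_0_compat; lra).
assert (HM : 0 < M) by (unfold M, C; lra).
exists M, J; split; auto.
induction n as [n IH] using (well_founded_induction Wf_nat.lt_wf); intros z Hz.
assert (HzJ : generic J z).
{ clear - Hz; revert z Hz; induction n as [|n IH]; intros z Hz; auto.
  apply IH; clear IH; simpl in Hz; revert z Hz; generalize (n + J)%nat as k.
  induction k as [|k IHk]; intros z [H1 [H2 H3]]; simpl; split; auto; split; apply IHk; auto. }
destruct (Hface z HzJ) as [c Hc].
destruct (Havg n c de Hde) as (z' & Hsq & Hz').
specialize (Hc z' Hsq).
assert (Hdn : 0 < jac ^ n) by (apply pow_lt; lra).
assert (Hn1 : npre n z' <= 2 / de ^ 2 * jac ^ n).
{ apply Rmult_le_reg_r with (de ^ 2); auto.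
  replace (2 / de ^ 2 * jac ^ n * de ^ 2) with (2 * jac ^ n) by (field; lra); auto. }
assert (Hkap : forall k, kap ^ k = r ^ k * jac ^ k) by (intros; rewrite <- Rpow_mult_distr; reflexivity).
assert (Hn2 : meet trap_bd n z z' <= 4 * C * jac ^ n).
{ eapply Rle_trans; [apply meet_le_lam|]; eapply Rle_trans; [apply laps_trap_bd|].
  rewrite Hkap; assert (0 <= r ^ n <= 1).
  { split; [apply pow_le; unfold r; lra|].
    rewrite <- (pow1 n); apply pow_incr; unfold r; lra. }
  unfold C; nra. }
assert (Hn3 : sumh n (fun j => 2 * meet top j z z' * (M * jac ^ (n - S j))) <= M / 2 * jac ^ n).
{ eapply Rle_trans with (sumh n (fun j => 2 * C * M * jac ^ n *
    (if Compare_dec.le_lt_dec j J then 0 else r ^ j))).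
  - apply sumh_le; intros j Hj; destruct (Compare_dec.le_lt_dec j J) as [H|H].
    + rewrite Hc by auto; lra.
    + assert (Hm : meet top j z z' <= C * (r ^ j * jac ^ j)).
      { eapply Rle_trans; [apply meet_le_lam|]; rewrite <- Hkap.
        generalize (laps_top j); unfold C; lra. }
      assert (Hd1 : 0 < jac ^ (n - S j)) by (apply pow_lt; lra).
      assert (Hd2 : jac ^ j * jac ^ (n - S j) <= jac ^ n).
      { rewrite <- pow_add; apply Rle_pow; [lra|lia]. }
      assert (0 <= r ^ j) by (apply pow_le; unfold r; lra).
      apply Rle_trans with (2 * (C * (r ^ j * jac ^ j)) * (M * jac ^ (n - S j))).
      { apply Rmult_le_compat_r; [|lra]; apply Rmult_le_pos; lra. }
      replace (2 * (C * (r ^ j * jac ^ j)) * (M * jac ^ (n - S j)))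
        with (2 * C * M * r ^ j * (jac ^ j * jac ^ (n - S j))) by ring.
      replace (2 * C * M * jac ^ n * r ^ j) with (2 * C * M * r ^ j * jac ^ n) by ring.
      apply Rmult_le_compat_l; auto.
      apply Rmult_le_pos; auto; apply Rmult_le_pos; [unfold C|]; lra.
  - rewrite sumh_scal.
    assert (Hr1 : 0 <= r < 1) by (unfold r; lra).
    generalize (sumh_geom_tail r J Hr1 n); intros HT.
    replace (1 / (1 - r)) with 500 in HT by (unfold r; field).
    assert (HC : 0 < C) by (unfold C; lra).
    assert (HJ' : r ^ J * 500 * (2 * C) <= 1 / 2).
    { apply Rmult_lt_compat_r with (r := 1000 * C) in HJ; [|lra].
      replace (1 / (2000 * C) * (1000 * C)) with (1 / 2) in HJ by (field; lra). lra. }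
    assert (HMd : 0 < M * jac ^ n) by (apply Rmult_lt_0_compat; auto).
    set (X := sumh n _) in *.
    replace (2 * C * M * jac ^ n * X) with (M * jac ^ n * (X * (2 * C))) by ring.
    replace (M / 2 * jac ^ n) with (M * jac ^ n * (1 / 2)) by field.
    apply Rmult_le_compat_l; [lra|]; eapply Rle_trans; [|exact HJ'].
    apply Rmult_le_compat_r; lra. }
assert (IH' : forall m z, (m < n)%nat -> generic (m + J) z -> npre m z <= M * jac ^ m) by auto.
assert (EM : M * jac ^ n = M / 2 * jac ^ n + 2 / de ^ 2 * jac ^ n + 4 * C * jac ^ n).
{ replace (M / 2) with (2 / de ^ 2 + 4 * C) by (unfold M; field; lra).
  unfold M at 1; ring. }
generalize (npre_diff J M n (Rlt_le _ _ HM) IH' z z' Hz); lra.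
Qed.

(** * The branches in a form suited to changes of variables *)

Definition h_slope (b : bool) : R := if b then / (2 * (1 - al)) else - / (2 * (1 - al)).
Definition h_const (b : bool) : R := if b then 0 else / (1 - al).

Lemma h_affine b z : h b z = (h_slope b * snd z + - (al / (1 - al)) * fst z + h_const b, fst z).
Proof. destruct z as [x y], b; unfold h, h_slope, h_const; simpl; f_equal; field; lra. Qed.

Lemma Rabs_h_slope b : Rabs (h_slope b) = / jac.
Proof.
unfold h_slope, jac; assert (0 < / (2 * (1 - al))) by (apply Rinv_0_lt_compat; lra).
destruct b; rewrite ?Rabs_Ropp; apply Rabs_right; lra.
Qed.

Lemma h_slope_neq0 b : h_slope b <> 0.
Proof.
unfold h_slope; assert (0 < / (2 * (1 - al))) by (apply Rinv_0_lt_compat; lra).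
destruct b; lra.
Qed.

Lemma G_g b z : on b z -> G al z = g b z.
Proof.
unfold on, G, g, tent, wmean; destruct b; intros H; destruct (Rlt_dec _ _); f_equal; lra.
Qed.

Lemma trap_unit_square z : trap z -> unit_square z.
Proof.
intros (H1 & H2 & H3); unfold unit_square.
assert (0 <= 2 * al * (1 - fst z)) by (apply Rmult_le_pos; lra).
repeat split; lra.
Qed.

Lemma al_neq0 : al <> 0.
Proof. lra. Qed.

(** With [G_g], this shows that off the fold line only the branch followed by [G al] contributes in
    [imassS]. *)
Lemma wmean_cases z : wmean z <> 1 / 2 ->
  (on true z /\ snd (g true z) < 1 /\ ~ snd (g false z) < 1) \/
  (on false z /\ ~ snd (g true z) < 1 /\ snd (g false z) < 1).
Proof. intros H; rewrite !snd_g_lt; unfold on; lra. Qed.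

Lemma trap_corner z : open_rect (1 / 2) 1 (1 / 2) 1 z -> trap z.
Proof.
destruct z as [x y]; unfold open_rect, trap; simpl; intros H.
assert (al * (1 - x) <= 1 / 3 * (1 / 2)) by (apply Rmult_le_compat; lra).
lra.
Qed.

End Dynamics.

(** The polynomial is nondecreasing on [[0, 1 / 3]], as its factored difference shows, and its value
    at [279 / 1000] is still below [1 / 2]. *)
Lemma alpha_bounds (alpha2 al : R) : 0 <= alpha2 ->
  8 * alpha2 ^ 4 - 8 * alpha2 ^ 3 + 8 * alpha2 ^ 2 = 1 / 2 -> alpha2 <= al <= 1 / 3 ->
  279 / 1000 <= al /\ 1 / 2 <= 8 * al ^ 4 - 8 * al ^ 3 + 8 * al ^ 2.
Proof.
intros H0 H2 Hal.
assert (P : forall x y, 0 <= x -> x <= y -> y <= 1 / 3 ->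
  8 * x ^ 4 - 8 * x ^ 3 + 8 * x ^ 2 <= 8 * y ^ 4 - 8 * y ^ 3 + 8 * y ^ 2).
{ intros x y Hx Hxy Hy.
  assert (0 <= (y - x) * (y ^ 3 + y ^ 2 * x + y * x ^ 2 + x ^ 3 + (x + y) * (1 - (x + y)) + x * y)).
  { apply Rmult_le_pos; [lra|].
    assert (0 <= (x + y) * (1 - (x + y))) by (apply Rmult_le_pos; lra).
    assert (0 <= x * y) by (apply Rmult_le_pos; lra).
    assert (0 <= y ^ 3 + y ^ 2 * x + y * x ^ 2 + x ^ 3).
    { repeat apply Rplus_le_le_0_compat; repeat apply Rmult_le_pos; try apply pow_le; lra. }
    lra. }
  lra. }
assert (Hlow : 1 / 2 <= 8 * al ^ 4 - 8 * al ^ 3 + 8 * al ^ 2) by (rewrite <- H2; apply P; lra).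
split; auto.
destruct (Rle_dec (279 / 1000) al) as [H|H]; auto.
generalize (P al (279 / 1000) ltac:(lra) ltac:(lra) ltac:(lra)); lra.
Qed.

From mathcomp Require Import all_boot all_order all_algebra.
From mathcomp Require Import boolp classical_sets functions reals ereal.
From mathcomp Require Import topology normedtype sequences numfun measure.
From mathcomp Require Import measurable_realfun lebesgue_measure lebesgue_integral.
From mathcomp Require Import lra Rstruct Rstruct_topology.
Import Order.TTheory GRing.Theory Num.Theory.
Import numFieldNormedType.Exports.

(** * Lebesgue measure on the plane and generalized limits *)

Notation leb2 := (lebesgue_measure \x lebesgue_measure)%E.

Section Measure.
Set Implicit Arguments.
Unset Strict Implicit.
Unset Printing Implicit Defensive.
Local Open Scope classical_set_scope.
Local Open Scope ring_scope.

Lemma measurable_affine1 (R : realType) (s c : R) :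
  measurable_fun [set: measurableTypeR R] (fun y : measurableTypeR R => s * y + c : measurableTypeR R).
Proof.
apply: measurable_funD => //; apply: measurable_funM => //.
Qed.

(** The image of Lebesgue measure, rescaled by the absolute value of [s], gives half-open intervals
    their length, so uniqueness applies. *)
Lemma lebesgue_measure_affine (R : realType) (s c : R) (A : set (measurableTypeR R)) :
  s != 0 -> measurable A ->
  lebesgue_measure ((fun y => s * y + c) @^-1` A) = (`|s|^-1%:E * lebesgue_measure A)%E.
Proof.
move=> s0 mA.
pose f := (fun y : measurableTypeR R => s * y + c : measurableTypeR R).
have mf : measurable_fun setT f by exact: measurable_affine1.
have ns0 : 0 <= `|s| by [].
pose mu : {measure set (measurableTypeR R) -> \bar R} :=
  mscale (NngNum ns0) (pushforward lebesgue_measure f).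
have E : lebesgue_measure A = mu mf A.
  apply: lebesgue_measure_unique mA => X [[a b] _ <-] /=.
  rewrite /mu /mscale /= /pushforward.
  have [s_gt0|s_lt0|/eqP] := ltrgt0P s; last by rewrite (negbTE s0).
  - have -> : f @^-1` [set` `]a, b]] = [set` `](a - c) / s, (b - c) / s]].
      apply/seteqP; split => y /=; rewrite !in_itv /= /f.
        by rewrite ltr_pdivrMr // ler_pdivlMr // => /andP[? ?]; apply/andP; split; lra.
      by rewrite ltr_pdivrMr // ler_pdivlMr // => /andP[? ?]; apply/andP; split; lra.
    rewrite !lebesgue_measure_itv /= !lte_fin ltr_pM2r ?invr_gt0 // ltrD2r.
    case: ifP => _; rewrite ?mule0 // -EFinB -EFinM; congr EFin.
    by rewrite -mulrBl mulrC -mulrA mulVf // mulr1; lra.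
  - have -> : f @^-1` [set` `]a, b]] = [set` `[(b - c) / s, (a - c) / s[].
      apply/seteqP; split => y /=; rewrite !in_itv /= /f.
        by rewrite ler_ndivrMr // ltr_ndivlMr // => /andP[? ?]; apply/andP; split; lra.
      by rewrite ler_ndivrMr // ltr_ndivlMr // => /andP[? ?]; apply/andP; split; lra.
    rewrite !lebesgue_measure_itv /= !lte_fin ltr_nM2r ?invr_lt0 // ltrD2r.
    case: ifP => _; rewrite ?mule0 // -EFinB -EFinM; congr EFin.
    by rewrite -mulrBl mulNr mulrC -mulrA mulVf // mulr1; lra.
rewrite E /mu /mscale /= /pushforward muleA -EFinM mulVf ?normr_eq0 // mul1e.
by [].
Qed.

Lemma measurable_affine2 (R : realType) (s q c : R) :
  measurable_fun [set: measurableTypeR R * measurableTypeR R]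
    (fun z : measurableTypeR R * measurableTypeR R =>
       (s * z.2 + q * z.1 + c, z.1) : measurableTypeR R * measurableTypeR R).
Proof.
apply/measurable_fun_pairP; split => /=; last exact: measurable_fst.
apply: measurable_funD => //; apply: measurable_funD; apply: measurable_funM => //.
Qed.

(** By uniqueness of the product measure rectangles suffice. The section over [x] is an affine
    preimage of the side [A] if [x] is in [B], and empty otherwise. *)
Lemma leb2_affine (R : realType) (s q c : R) (X : set (measurableTypeR R * measurableTypeR R)) :
  s != 0 -> measurable X ->
  leb2 ((fun z => (s * z.2 + q * z.1 + c, z.1)) @^-1` X) = (`|s|^-1%:E * leb2 X)%E.
Proof.
move=> s0 mX.
pose f := (fun z : measurableTypeR R * measurableTypeR R =>
  (s * z.2 + q * z.1 + c, z.1) : measurableTypeR R * measurableTypeR R).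
have mf : measurable_fun setT f by exact: measurable_affine2.
have ns0 : 0 <= `|s| by [].
pose mu : {measure set (measurableTypeR R * measurableTypeR R) -> \bar R} :=
  mscale (NngNum ns0) (pushforward leb2 f).
have E : leb2 X = mu mf X.
  apply: product_measure_unique mX => A B mA mB /=.
  rewrite /mu /mscale /= /pushforward /product_measure1 /=.
  rewrite (eq_integral (fun x => (`|s|^-1%:E * lebesgue_measure A) * (\1_B x)%:E)%E); last first.
    move=> x _; rewrite indicE.
    have [/set_mem xB|/negP xB] := boolP (x \in B).
      rewrite mule1 -(@lebesgue_measure_affine _ s (q * x + c)) //.
      congr (lebesgue_measure _); apply/seteqP; split => y; rewrite /xsection /= inE /f /= addrA //.
      by move=> [].
    rewrite mule0 (_ : xsection _ _ = set0) ?measure0 //.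
    by apply/seteqP; split => y //; rewrite /xsection /= inE /f /= => -[_ xB']; apply: xB; rewrite inE.
  rewrite ge0_integralZl //=; last 2 first.
  - exact: measurableT_comp.
  - by rewrite mule_ge0.
  rewrite integral_indic // setIT muleA muleA -EFinM mulfV ?normr_eq0 // mul1e //.
rewrite E /mu /mscale /= /pushforward muleA -EFinM mulVf ?normr_eq0 // mul1e.
by [].
Qed.

Lemma ge0_integral_affine2 (R : realType) (s q c : R)
    (F : measurableTypeR R * measurableTypeR R -> \bar R) :
  s != 0 -> measurable_fun setT F -> (forall z, 0 <= F z)%E ->
  (\int[leb2]_z F ((s * z.2 + q * z.1 + c)%R, z.1) = `|s|^-1%:E * \int[leb2]_z F z)%E.
Proof.
move=> s0 mF F0.
pose f := (fun z : measurableTypeR R * measurableTypeR R =>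
  (s * z.2 + q * z.1 + c, z.1) : measurableTypeR R * measurableTypeR R).
have mf : measurable_fun setT f by exact: measurable_affine2.
have ns0 : 0 <= `|s|^-1 by rewrite invr_ge0.
have := @ge0_integral_pushforward _ _ _ _ R f mf leb2 setT F measurableT mF (fun y _ => F0 y).
rewrite preimage_setT => /esym -> .
have -> : (\int[pushforward leb2 f]_y F y =
    \int[mscale (NngNum ns0) leb2]_y F y)%E.
  apply: eq_measure_integral => A mA _.
  by rewrite /mscale /= /pushforward leb2_affine.
by rewrite ge0_integral_mscale.
Qed.

(** * Generalized limits *)

Lemma ultra_cvg (R : realType) (U : set_system nat) (u : nat -> R) (a b : R) :
  UltraFilter U -> (forall n, a <= u n <= b) -> cvg (u @ U).
Proof.
move=> UU uab.
have PF : ProperFilter (u @ U) by exact: fmap_proper_filter.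
have Uab : (u @ U) [set` `[a, b]].
  by rewrite /fmap /=; apply: filterE => n; rewrite /= in_itv /= uab.
have [p [_ clp]] := @segment_compact R a b _ PF Uab.
apply/cvg_ex; exists p => V Vp.
have [//|UC] := in_ultra_setVsetC (u @^-1` V) UU.
have [x [/= xV xV']] : ((~` V) `&` V) !=set0 by exact: clp.
by [].
Qed.

Definition bounded_seq (R : realType) (u : nat -> R) := exists M, forall n, `|u n| <= M.

(** The limit along an ultrafilter finer than [\oo], which exists for bounded sequences by
    compactness. *)
Lemma generalized_limit (R : realType) : exists L : (nat -> R) -> R,
  [/\ forall u v, bounded_seq u -> bounded_seq v -> L (fun n => u n + v n) = L u + L v,
      forall u v, bounded_seq u -> bounded_seq v -> (forall n, u n <= v n) -> L u <= L v &
      forall u l, u @ \oo --> l -> L u = l].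
Proof.
have [U [UU FU]] := @ultraFilterLemma nat \oo _.
have ucvg u : bounded_seq u -> cvg (u @ U).
  by move=> [M uM]; apply: (@ultra_cvg _ _ _ (- M) M) => // n; rewrite -ler_norml.
exists (fun u => lim (u @ U)); split.
- move=> u v /ucvg cu /ucvg cv; apply: cvg_lim => //; exact: cvgD.
- move=> u v /ucvg cu /ucvg cv uv; apply: ler_lim => //; exact: filterE.
- move=> u l ul; apply: cvg_lim => //; apply: cvg_trans ul => V; exact: FU.
Qed.

(** * Borel sets and areas of rectangles *)

Local Notation T2 := (measurableTypeR R * measurableTypeR R)%type.

Lemma measurable_open_rect (a b c d : R) : measurable (open_rect a b c d : set T2).
Proof.
have -> : (open_rect a b c d : set T2) = [set` `]a, b[] `*` [set` `]c, d[].
  apply/seteqP; split => -[x y]; rewrite /open_rect /= !in_itv /=.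
    by move=> [[/RltP -> /RltP ->] [/RltP -> /RltP ->]].
  by move=> [/andP[/RltP ? /RltP ?] /andP[/RltP ? /RltP ?]].
exact: measurableX.
Qed.

Lemma borel_measurable (A : set2) : borel A -> measurable (A : set T2).
Proof.
elim=> {A} [a b c d|A _ mA|A _ mA].
- exact: measurable_open_rect.
- exact: measurableC.
- have -> : ((fun p => exists n, A n p) : set T2) = \bigcup_n (A n).
    by apply/seteqP; split => z [n]; [exists n | exists n].
  exact: bigcupT_measurable.
Qed.

Lemma leb2_open_rect (a b c d : R) : a <= b -> c <= d ->
  leb2 (open_rect a b c d : set T2) = (((b - a) * (d - c))%:E : \bar R).
Proof.
move=> ab cd.
have -> : (open_rect a b c d : set T2) = [set` `]a, b[] `*` [set` `]c, d[].
  apply/seteqP; split => -[x y]; rewrite /open_rect /= !in_itv /=.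
    by move=> [[/RltP -> /RltP ->] [/RltP -> /RltP ->]].
  by move=> [/andP[/RltP ? /RltP ?] /andP[/RltP ? /RltP ?]].
rewrite product_measure1E //= !lebesgue_measure_itv /= !lte_fin.
move: ab; rewrite le_eqVlt => /predU1P[<-|ab]; first by rewrite ltxx subrr mul0r mul0e.
move: cd; rewrite le_eqVlt => /predU1P[<-|cd]; first by rewrite ltxx subrr mulr0 mule0.
by rewrite ab cd -!EFinB -EFinM.
Qed.

End Measure.

(** * The invariant measure *)

Section Density.
Variable al : R.
Hypothesis al_lo : 279 / 1000 <= al.
Hypothesis al_hi : al <= 1 / 3.
Hypothesis al_eq : 1 / 2 <= 8 * al ^ 4 - 8 * al ^ 3 + 8 * al ^ 2.

Set Implicit Arguments.
Unset Strict Implicit.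
Unset Printing Implicit Defensive.
Local Open Scope classical_set_scope.
Local Open Scope ring_scope.

Local Notation T2 := (measurableTypeR R * measurableTypeR R)%type.
Local Notation trap := (trap al).
Local Notation npre := (npre al).
Local Notation jac := (jac al).

(** * Measurability, and null sets of nongeneric points *)

Lemma measurable_h b : measurable_fun [set: T2] (h al b : T2 -> T2).
Proof.
rewrite (_ : h al b = fun z => (h_slope al b * z.2 + - (al / (1 - al)) * z.1 + h_const al b, z.1)).
  exact: measurable_affine2.
by apply/funext => z; rewrite (h_affine _ al_hi).
Qed.

Lemma leb2_h b (X : set T2) : measurable X ->
  leb2 ((h al b : T2 -> T2) @^-1` X) = (jac%:E * leb2 X)%E.
Proof.
move=> mX.
rewrite (_ : h al b = fun z => (h_slope al b * z.2 + - (al / (1 - al)) * z.1 + h_const al b, z.1)).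
  rewrite leb2_affine //; last by apply/eqP; exact: h_slope_neq0.
  by rewrite -RabsE (Rabs_h_slope _ al_hi) RinvE invrK.
by apply/funext => z; rewrite (h_affine _ al_hi).
Qed.

Lemma integral_h b (F : T2 -> \bar R) : measurable_fun setT F -> (forall z, 0 <= F z)%E ->
  (\int[leb2]_z F (h al b z) = jac%:E * \int[leb2]_z F z)%E.
Proof.
move=> mF F0.
under eq_integral do rewrite (h_affine _ al_hi).
rewrite (@ge0_integral_affine2 _ (h_slope al b) (- (al / (1 - al))) (h_const al b)) //.
  by rewrite -RabsE (Rabs_h_slope _ al_hi) RinvE invrK.
by apply/eqP; exact: h_slope_neq0.
Qed.

Definition wall : set T2 := [set z | z.2 = 1].

Lemma measurable_wall : measurable wall.
Proof.
rewrite (_ : wall = setT `*` [set 1]); last by apply/seteqP; split => -[x y] //= [].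
exact: measurableX.
Qed.

Lemma leb2_wall : leb2 wall = (0 : \bar R)%E.
Proof.
rewrite (_ : wall = setT `*` [set 1]); last by apply/seteqP; split => -[x y] //= [].
by rewrite product_measure1E //= lebesgue_measure_set1 mule0.
Qed.

Definition nongeneric M : set T2 := [set z | ~ generic al M z].

Lemma nongenericS M : nongeneric M.+1 = wall `|` (h al true @^-1` nongeneric M `|` h al false @^-1` nongeneric M).
Proof.
apply/seteqP; split => z; rewrite /nongeneric /wall /=.
  move=> N; have [?|Hz] := pselect (z.2 = 1); [by left | right].
  have [G1|G1] := pselect (generic al M (h al true z)); [right | by left].
  by move=> G2; apply: N.
by move=> [E [] //|[N [_ []]//|N [_ []]//]].
Qed.

Lemma nongeneric0 : nongeneric 0 = wall.
Proof.
apply/seteqP; split => z; rewrite /nongeneric /wall /=; last by move=> E [].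
by move=> N; apply: contrapT => Hz; apply: N.
Qed.

Lemma measurable_nongeneric M : measurable (nongeneric M).
Proof.
elim: M => [|M IH]; first by rewrite nongeneric0; exact: measurable_wall.
rewrite nongenericS; apply: measurableU; first exact: measurable_wall.
by apply: measurableU; rewrite -[X in measurable X]setTI; exact: measurable_h.
Qed.

Lemma leb2_nongeneric M : leb2 (nongeneric M) = (0 : \bar R)%E.
Proof.
elim: M => [|M IH]; first by rewrite nongeneric0 leb2_wall.
have mP b : measurable (h al b @^-1` nongeneric M : set T2).
  by rewrite -[X in measurable X]setTI; exact: measurable_h (measurable_nongeneric M).
have P0 b : leb2 (h al b @^-1` nongeneric M : set T2) = (0 : \bar R)%E.
  by rewrite leb2_h ?IH ?mule0 //; exact: measurable_nongeneric.
rewrite nongenericS measureU0 //=.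
- exact: leb2_wall.
- exact: measurable_wall.
- exact: measurableU.
- by rewrite measureU0 //=.
Qed.

Lemma measurable_lt1 : measurable ([set z | z.2 < 1] : set T2).
Proof.
rewrite (_ : mkset _ = setT `*` [set` `]-oo, 1[]); first exact: measurableX.
by apply/seteqP; split => -[x y] //=; rewrite in_itv //= => -[].
Qed.

Lemma measurable_trap : measurable (trap : set T2).
Proof.
have -> : (trap : set T2) = [set z | 0 <= z.1] `&` [set z | z.1 <= 1] `&` [set z | z.2 <= 1] `&`
    [set z | 2 * al * (1 - z.1) <= z.2].
  apply/seteqP; split => z.
    by move=> [[/RleP ? /RleP ?] [/RleP ? /RleP ?]].
  by move=> [[[/RleP ? /RleP ?] /RleP ?] /RleP ?].
have mle (f g : T2 -> measurableTypeR R) : measurable_fun setT f -> measurable_fun setT g ->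
    measurable [set z | f z <= g z].
  move=> mf mg; rewrite (_ : mkset _ = (fun z => f z <= g z) @^-1` [set true]) //.
  rewrite -[X in measurable X]setTI; exact: measurable_fun_ler.
do 3?[apply: measurableI]; apply: mle => //.
apply: measurable_funM => //; apply: measurable_funB => //.
Qed.

Lemma npre0E z : npre 0 z = \1_(trap : set T2) z.
Proof.
rewrite indicE /=; have [H|H] := boolP (z \in (trap : set T2)).
  by rewrite indic_true //; exact: set_mem H.
by rewrite indic_false // => H'; move/negP: H; apply; rewrite inE.
Qed.

Lemma npreSE n z : npre n.+1 z =
  \1_([set z | z.2 < 1] : set T2) z * (npre n (h al true z) + npre n (h al false z)).
Proof.
rewrite indicE /=; case: Rlt_dec => [/RltP H|H].
  by rewrite mem_set // mul1r.
by rewrite memNset ?mul0r // => /RltP.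
Qed.

Lemma measurable_npre n : measurable_fun [set: T2] (npre n : T2 -> measurableTypeR R).
Proof.
elim: n => [|n IH].
  rewrite (_ : npre 0 = \1_(trap : set T2)); first exact: measurable_indic measurable_trap.
  by apply/funext => z; rewrite npre0E.
rewrite (_ : npre n.+1 = fun z : T2 => \1_([set z | z.2 < 1] : set T2) z *
  (npre n (h al true z) + npre n (h al false z))); last by apply/funext => z; rewrite npreSE.
apply: measurable_funM; first exact: measurable_indic measurable_lt1.
by apply: measurable_funD; apply: (measurableT_comp IH); exact: measurable_h.
Qed.

Lemma measurable_g b : measurable_fun [set: T2] (g al b : T2 -> T2).
Proof.
apply/measurable_fun_pairP; split; first exact: measurable_snd.
have mu : measurable_fun [set: T2] (wmean al : T2 -> measurableTypeR R).
  by apply: measurable_funD; apply: measurable_funM.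
have m2u : measurable_fun [set: T2] (fun z : T2 => 2 * wmean al z : measurableTypeR R).
  exact: measurable_funM.
case: b; first exact: m2u.
have : measurable_fun [set: T2] (fun z : T2 => 2 - 2 * wmean al z : measurableTypeR R).
  exact: measurable_funB.
exact.
Qed.

Lemma measurable_G : measurable_fun [set: T2] (G al : T2 -> T2).
Proof.
rewrite (_ : G al = fun z => if wmean al z <= Rdiv 1 2 then g al true z else g al false z).
  apply: measurable_fun_ifT; try exact: measurable_g.
  apply: measurable_fun_ler => //.
  by apply: measurable_funD; apply: measurable_funM.
apply/funext => z; case: ifPn => [/RleP H|/RleP H]; apply: G_g => //.
exact/Rlt_le/Rnot_le_lt.
Qed.

(** * Masses of the iterated images *)

Definition fold_line : set T2 := [set z | wmean al z = Rdiv 1 2].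

Lemma fold_lineE : fold_line =
  (fun z : T2 => (al * z.2 + (1 - al) * z.1 + 0, z.1)) @^-1` ([set Rdiv 1 2] `*` setT).
Proof.
by apply/seteqP; split => z; rewrite /fold_line /wmean /= addr0 => // -[].
Qed.

Lemma measurable_fold_line : measurable fold_line.
Proof.
rewrite fold_lineE -[X in measurable X]setTI; apply: measurable_affine2 => //.
exact: measurableX.
Qed.

Lemma leb2_fold_line : leb2 fold_line = (0 : \bar R)%E.
Proof.
rewrite fold_lineE leb2_affine.
- by rewrite product_measure1E //= lebesgue_measure_set1 mul0e mule0.
- by apply/eqP; apply: al_neq0.
- exact: measurableX.
Qed.

(** The mass of [A] under the [n]-th image of Lebesgue measure on [trap], times [jac ^ n]. *)
Definition imass n (A : set T2) : \bar R := (\int[leb2]_(z in A) (npre n z)%:E)%E.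

Lemma npre_ge0' n z : (0 <= (npre n z)%:E :> \bar R)%E.
Proof. by rewrite lee_fin; apply/RleP; exact: npre_ge0. Qed.

Lemma measurable_npreE n (D : set T2) : measurable_fun D (fun z : T2 => (npre n z)%:E).
Proof.
apply: measurable_funTS; apply/measurable_EFinP; exact: measurable_npre.
Qed.

Lemma imassE n (A : set T2) : imass n A = (\int[leb2]_z (\1_A z * npre n z)%:E)%E.
Proof.
rewrite /imass integral_mkcond; apply: eq_integral => z _.
by rewrite patchE indicE; case: ifP => _; rewrite ?mul1r ?mul0r.
Qed.

(** Each of the two terms of [npre n.+1] is integrated by substituting [g b], at the cost of a
    factor [jac]; at almost every point exactly one of the two resulting terms survives, the one
    where [g b] is [G al]. *)
Lemma imassS n (A : set T2) : measurable A -> imass n.+1 A = (jac%:E * imass n (G al @^-1` A))%E.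
Proof.
move=> mA.
pose B := A `&` [set z : T2 | z.2 < 1].
have mB : measurable B by apply: measurableI => //; exact: measurable_lt1.
pose F b (z : T2) := (\1_B (g al b z) * npre n z)%:E : \bar R.
have F0 b z : (0 <= F b z)%E.
  by rewrite /F EFinM mule_ge0 ?npre_ge0' // lee_fin.
have mF b : measurable_fun setT (F b).
  apply/measurable_EFinP; apply: measurable_funM; last exact: measurable_npre.
  have m1 : measurable_fun [set: T2] (\1_B : T2 -> measurableTypeR R) by exact: measurable_indic.
  exact: (measurableT_comp m1 (measurable_g b)).
rewrite [LHS]imassE.
rewrite (eq_integral (fun z : T2 => F true (h al true z) + F false (h al false z))%E); last first.
  move=> z _; rewrite /F !(g_h _ al_hi) npreSE -EFinD; congr EFin.
  by rewrite /B indicI /= mulrA -mulrDr.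
rewrite ge0_integralD //=; first last.
- by apply: (measurableT_comp (mF false)); exact: measurable_h.
- by apply: (measurableT_comp (mF true)); exact: measurable_h.
rewrite !integral_h // -ge0_muleDr ?integral_ge0 //; congr (_ * _)%E.
rewrite -ge0_integralD // imassE.
apply: ge0_ae_eq_integral => //.
- exact: emeasurable_funD.
- apply/measurable_EFinP; apply: measurable_funM; last exact: measurable_npre.
  apply: measurable_indic; rewrite -[X in measurable X]setTI; exact: measurable_G.
- by move=> z _; rewrite adde_ge0.
- by move=> z _; rewrite EFinM mule_ge0 ?npre_ge0' // lee_fin.
exists fold_line; split; [exact: measurable_fold_line|exact: leb2_fold_line|].
move=> z; apply: contraPP => Hz /=; apply; move=> _.
rewrite /F -EFinD -mulrDl; congr (_ * _)%:E.
rewrite /B !indicI /=.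
rewrite !indicE.
case: (wmean_cases _ _ Hz) => [[Hon [/RltP H1 H2]]|[Hon [H1 /RltP H2]]].
- rewrite (mem_set (H1 : [set z : T2 | z.2 < 1] (g al true z))).
  rewrite (memNset (A := [set z : T2 | z.2 < 1]) (u := g al false z)); last by move=> /RltP.
  by rewrite mulr1 mulr0 addr0 -(G_g _ _ _ Hon).
- rewrite (mem_set (H2 : [set z : T2 | z.2 < 1] (g al false z))).
  rewrite (memNset (A := [set z : T2 | z.2 < 1]) (u := g al true z)); last by move=> /RltP.
  by rewrite mulr1 mulr0 add0r -(G_g _ _ _ Hon).
Qed.

Lemma jac_gt0 n : 0 < jac ^+ n.
Proof.
apply: exprn_gt0; apply/RltP; case: (jac_bounds _ al_lo al_hi) => + _.
by apply: Rlt_le_trans; apply: Rdiv_lt_0_compat; [exact: (IZR_lt 0 4) | exact: (IZR_lt 0 3)].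
Qed.

Lemma jac_ge0 n : 0 <= jac ^+ n.
Proof. exact/ltW/jac_gt0. Qed.

Lemma leb2_unit_square : leb2 (`[0, 1] `*` `[0, 1] : set T2) = (1 : \bar R)%E.
Proof.
by rewrite product_measure1E //= !lebesgue_measure_itv /= !lte_fin !ltr01 !sube0 mule1.
Qed.

Lemma trap_sub_square : (trap : set T2) `<=` (`[0, 1] `*` `[0, 1] : set T2).
Proof.
move=> z /(trap_unit_square _ al_lo _) [[/RleP ? /RleP ?] [/RleP ? /RleP ?]].
by split => /=; rewrite in_itv /=; apply/andP.
Qed.

Lemma imass_setT n : imass n setT = ((jac ^+ n)%:E * leb2 (trap : set T2))%E.
Proof.
elim: n => [|n IH].
  rewrite imassE expr0 mul1e.
  under eq_integral do rewrite indicT mul1r npre0E.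
  by rewrite integral_indic ?setIT //; exact: measurable_trap.
by rewrite imassS // preimage_setT IH muleA -EFinM exprS.
Qed.

Lemma imass_ge0 n (A : set T2) : (0 <= imass n A)%E.
Proof. by apply: integral_ge0 => z _; exact: npre_ge0'. Qed.

Lemma imass_le n (A B : set T2) : measurable A -> measurable B -> A `<=` B ->
  (imass n A <= imass n B)%E.
Proof.
move=> mA mB AB; apply: ge0_subset_integral => //; first exact: measurable_npreE.
by move=> z _; exact: npre_ge0'.
Qed.

Lemma imass_setT_le n : (imass n setT <= (jac ^+ n)%:E)%E.
Proof.
rewrite imass_setT -[leRHS]mule1; apply: lee_pmul => //.
- by rewrite lee_fin jac_ge0.
- rewrite -leb2_unit_square; apply: le_measure; rewrite ?inE.
  + exact: measurable_trap.
  + exact: measurableX.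
  + exact: trap_sub_square.
Qed.

(** Otherwise the integral over the square would be at least [2 * jac ^ n], whereas the total mass
    is at most [jac ^ n]. *)
Lemma square_average n c de : Rlt 0 de ->
  exists z', square c de z' /\ Rle (Rmult (npre n z') (pow de 2)) (Rmult 2 (pow jac n)).
Proof.
move=> de0; apply: contrapT => H.
have /RltP de0' := de0.
have mS : measurable (square c de : set T2) by exact: measurable_open_rect.
have Hlow (z : T2) : square c de z -> 2 * jac ^+ n / de ^+ 2 <= npre n z.
  move=> Hz; rewrite ler_pdivrMr ?exprn_gt0 //; apply/RleP.
  have [//|/Rnot_le_lt] := Classical_Prop.classic
    (Rle (2 * jac ^+ n) (npre n z * de ^+ 2)).
  move=> K; exfalso; apply: H; exists z; split => //.
  by rewrite !RpowE; apply: Rlt_le.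
have I1 : ((2 * jac ^+ n)%:E <= imass n (square c de))%E.
  have -> : (2 * jac ^+ n)%:E = (\int[leb2]_(z in (square c de : set T2)) (2 * jac ^+ n / de ^+ 2)%:E)%E.
    rewrite integral_cst //= /square leb2_open_rect ?lerDl ?ltW //.
    rewrite -EFinM; congr EFin; rewrite !(addrAC _ de) !subrr !add0r -expr2.
    by rewrite divfK // expf_neq0 // gt_eqF.
  apply: ge0_le_integral => //.
  - by move=> z _; rewrite lee_fin divr_ge0 ?exprn_ge0 ?mulr_ge0 ?jac_ge0 ?ltW.
  - exact: measurable_npreE.
have I2 : ((2 * jac ^+ n)%:E <= (jac ^+ n)%:E :> \bar R)%E.
  apply: (le_trans I1); apply: (le_trans _ (imass_setT_le n)).
  exact: imass_le.
by move: I2; rewrite lee_fin mulr_natl mulr2n gerDl leNgt jac_gt0.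
Qed.

(** The pointwise bound holds at generic points, and the others form a null set. *)
Lemma imass_bound : exists2 M : R, 0 < M &
  forall n (A : set T2), measurable A -> (imass n A <= (M * jac ^+ n)%:E * leb2 A)%E.
Proof.
have [M [J [/RltP M0 HM]]] := npre_bounded _ al_lo al_hi al_eq square_average.
exists M => // n A mA.
have mN := measurable_nongeneric (n + J).
have mI : measurable (A `&` nongeneric (n + J)) by exact: measurableI.
have mD : measurable (A `\` nongeneric (n + J)) by exact: measurableD.
rewrite /imass -[X in integral _ X](setUIDK A (nongeneric (n + J))).
rewrite ge0_integral_setU //; [|exact: measurable_npreE|by move=> z _; exact: npre_ge0'|]; last first.
  by rewrite disj_set2E; apply/eqP/seteqP; split => z // [[_ ?] [_ ?]].
rewrite null_set_integral ?add0e //; [|exact: measurable_npreE|]; last first.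
  apply/eqP; rewrite eq_le measure_ge0 andbT -(leb2_nongeneric (n + J)).
  by apply: le_measure; rewrite ?inE //; exact: subIsetr.
apply: (@le_trans _ _ (\int[leb2]_(z in A `\` nongeneric (n + J)) (M * jac ^+ n)%:E)%E).
  apply: ge0_le_integral => //.
  - by move=> z _; exact: npre_ge0'.
  - exact: measurable_npreE.
  - move=> z [_ /contrapT Hz]; rewrite lee_fin -RpowE; apply/RleP; exact: HM.
rewrite integral_cst // lee_wpmul2l ?lee_fin ?mulr_ge0 ?jac_ge0 ?(ltW M0) //.
by apply: le_measure; rewrite ?inE //; exact: subDsetl.
Qed.

Lemma imass_trap n (A : set T2) : imass n A = imass n (A `&` (trap : set T2)).
Proof.
rewrite /imass integral_mkcondr; apply: eq_integral => z _.
rewrite patchE; case: ifPn => // /negP H.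
by rewrite (npre_supp _ al_lo al_hi) // => Hz; apply: H; rewrite inE.
Qed.

Lemma imass_setU n (A B : set T2) : measurable A -> measurable B -> [disjoint A & B] ->
  imass n (A `|` B) = (imass n A + imass n B)%E.
Proof.
move=> mA mB AB; apply: ge0_integral_setU => //; first exact: measurable_npreE.
by move=> z _; exact: npre_ge0'.
Qed.

Definition mass n (A : set T2) : R := fine (imass n A) / jac ^+ n.

Lemma imass_fin n (A : set T2) : measurable A -> imass n A \is a fin_num.
Proof.
move=> mA; rewrite ge0_fin_numE ?imass_ge0 //.
apply: (@le_lt_trans _ _ (imass n setT)); first exact: imass_le.
by apply: (le_lt_trans (imass_setT_le n)); rewrite ltry.
Qed.

Lemma mass_ge0 n (A : set T2) : 0 <= mass n A.
Proof. by rewrite divr_ge0 ?fine_ge0 ?imass_ge0 ?jac_ge0. Qed.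

Lemma mass_le1 n (A : set T2) : measurable A -> mass n A <= 1.
Proof.
move=> mA; rewrite ler_pdivrMr ?jac_gt0 // mul1r -lee_fin fineK ?imass_fin //.
by apply: le_trans (imass_setT_le n); exact: imass_le.
Qed.

Lemma mass_setU n (A B : set T2) : measurable A -> measurable B -> [disjoint A & B] ->
  mass n (A `|` B) = mass n A + mass n B.
Proof.
move=> mA mB AB; rewrite /mass imass_setU // fineD ?imass_fin //.
exact: mulrDl.
Qed.

Lemma massS n (A : set T2) : measurable A -> mass n.+1 A = mass n (G al @^-1` A).
Proof.
move=> mA; have d0 : jac != 0 by rewrite gt_eqF // -(expr1 jac) jac_gt0.
have mGA : measurable (G al @^-1` A : set T2).
  by rewrite -[X in measurable X]setTI; exact: measurable_G.
rewrite /mass imassS // fineM ?imass_fin //= exprS.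
have cancel (a b c : R) : a != 0 -> a * b / (a * c) = b / c.
  by move=> a0; rewrite -mulf_div divff // mul1r.
exact: cancel.
Qed.

Lemma mass_trap n (A : set T2) : mass n A = mass n (A `&` (trap : set T2)).
Proof. by rewrite /mass imass_trap. Qed.

Lemma leb2_trap_fin (A : set T2) : measurable A ->
  (leb2 (A `&` (trap : set T2)) : \bar R) \is a fin_num.
Proof.
move=> mA; rewrite ge0_fin_numE ?measure_ge0 //.
apply: (@le_lt_trans _ _ (leb2 (`[0, 1] `*` `[0, 1] : set T2))).
  apply: le_measure; rewrite ?inE; first by apply: measurableI => //; exact: measurable_trap.
    exact: measurableX.
  by apply: subset_trans trap_sub_square; exact: subIsetr.
by rewrite leb2_unit_square ltry.
Qed.

Definition area (A : set T2) : R := fine (leb2 (A `&` (trap : set T2)) : \bar R).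

Lemma mass_setT n : mass n setT = area setT.
Proof.
have := leb2_trap_fin measurableT; rewrite setTI => fT.
rewrite /mass imass_setT /area setTI fineM //=.
have cancel (a b : R) : a != 0 -> a * b / a = b by move=> a0; rewrite mulrC mulKf.
by apply: cancel; rewrite gt_eqF // jac_gt0.
Qed.

Lemma area_gt0 : 0 < area setT.
Proof.
have mT := measurable_trap.
have := leb2_trap_fin measurableT; rewrite /area setTI => fT.
rewrite -lte_fin fineK //.
apply: (@lt_le_trans _ _ (leb2 (open_rect (Rdiv 1 2) 1 (Rdiv 1 2) 1 : set T2))).
  have -> : Rdiv 1 2 = 2^-1 :> R by rewrite RdivE mul1r.
  rewrite leb2_open_rect ?invf_le1 ?ler1n //.
  by rewrite lte_fin mulr_gt0 // subr_gt0 invf_lt1 // ltr1n.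
apply: le_measure; rewrite ?inE //; first exact: measurable_open_rect.
by move=> z; apply: trap_corner.
Qed.

Lemma mass_bound : exists2 M : R, 0 < M & forall n A, measurable A -> mass n A <= M * area A.
Proof.
have [M M0 HM] := imass_bound; exists M => // n A mA.
have mI : measurable (A `&` (trap : set T2)) by apply: measurableI => //; exact: measurable_trap.
rewrite mass_trap /mass ler_pdivrMr ?jac_gt0 // -lee_fin fineK ?imass_fin //.
apply: (le_trans (HM n _ mI)).
by rewrite /area [in leRHS]mulrAC [in leRHS]EFinM fineK ?leb2_trap_fin.
Qed.

(** * Cesaro averages and their generalized limit *)

Definition cesaro (A : set T2) (N : nat) : R := (\sum_(0 <= k < N.+1) mass k A) / N.+1%:R.

Lemma cesaro_ge0 (A : set T2) N : 0 <= cesaro A N.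
Proof. by rewrite divr_ge0 // sumr_ge0 // => k _; exact: mass_ge0. Qed.

Lemma cesaro_le (A : set T2) N (c : R) : (forall k, mass k A <= c) -> cesaro A N <= c.
Proof.
move=> H; rewrite ler_pdivrMr ?ltr0n //.
apply: (@le_trans _ _ (\sum_(0 <= k < N.+1) c)); first by apply: ler_sum => k _; exact: H.
by rewrite sumr_const_nat subn0 mulr_natr.
Qed.

Lemma bounded_cesaro (A : set T2) : measurable A -> bounded_seq (cesaro A).
Proof.
move=> mA; exists 1 => N; rewrite ger0_norm ?cesaro_ge0 //.
by apply: cesaro_le => k; exact: mass_le1.
Qed.

Lemma cesaro_setU (A B : set T2) : measurable A -> measurable B -> [disjoint A & B] ->
  cesaro (A `|` B) = fun N => cesaro A N + cesaro B N.
Proof.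
move=> mA mB AB; apply/funext => N; rewrite /cesaro -mulrDl -big_split /=.
by congr (_ / _); apply: eq_bigr => k _; exact: mass_setU.
Qed.

(** The difference telescopes to its two extreme terms, both in [[0, 1]], divided by [N.+1]. *)
Lemma cesaro_G (A : set T2) : measurable A ->
  (fun N => cesaro (G al @^-1` A) N - cesaro A N) @ \oo --> (0 : R).
Proof.
move=> mA.
have E N : cesaro (G al @^-1` A) N - cesaro A N = (mass N.+1 A - mass 0 A) / N.+1%:R.
  rewrite /cesaro -mulrBl; congr (_ / _).
  rewrite (eq_bigr (fun k => mass k.+1 A)); last by move=> k _; rewrite massS.
  by rewrite -sumrB telescope_sumr.
have mGA : measurable (G al @^-1` A : set T2).
  by rewrite -[X in measurable X]setTI; exact: measurable_G.
have h0 : (fun N => - @harmonic R N) @ \oo --> (0 : R).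
  by have := cvgN (@cvg_harmonic R); rewrite oppr0; exact.
apply: (squeeze_cvgr _ h0 (@cvg_harmonic R)).
apply: nearW => N; rewrite E /harmonic /=.
have d1 : - 1 <= mass N.+1 A - mass 0 A <= 1.
  have := mass_ge0 N.+1 A; have := mass_ge0 0 A.
  have := mass_le1 N.+1 mA; have := mass_le1 0 mA; lra.
have iN : 0 <= N.+1%:R^-1 :> R by rewrite invr_ge0.
case/andP: d1 => d1 d2; apply/andP; split.
  by rewrite -mulN1r ler_wpM2r.
by rewrite -[leRHS]mul1r ler_wpM2r.
Qed.

Lemma area_null (A : set2) : borel A -> lebesgue_null A -> area A = 0.
Proof.
move=> bA nA; have mA := borel_measurable bA.
have mAT : measurable ((A : set T2) `&` (trap : set T2) : set T2) by apply: measurableI => //; exact: measurable_trap.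
suff A0 : leb2 (A : set T2) = (0 : \bar R)%E.
  rewrite /area (_ : leb2 _ = 0%E) //; apply/eqP; rewrite eq_le measure_ge0 andbT -A0.
  by apply: le_measure; rewrite ?inE //; exact: subIsetl.
apply/eqP; rewrite eq_le measure_ge0 andbT; apply/lee_addgt0Pr => e e0; rewrite add0e.
have /RltP e0' := e0.
have [a [b [c [d [abcd [Acov Asum]]]]]] := nA e e0'.
pose F n : set T2 := open_rect (a n) (b n) (c n) (d n).
have mF n : measurable (F n) by exact: measurable_open_rect.
have FE n : leb2 (F n) = (((b n - a n) * (d n - c n))%:E : \bar R).
  by rewrite leb2_open_rect //; apply/RleP; case: (abcd n).
apply: (@le_trans _ _ (\sum_(n <oo) leb2 (F n))%E).
  apply: measure_sigma_subadditive => // z Az.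
  by have [n Hn] := Acov z Az; exists n.
apply: lime_le; first by apply: is_cvg_nneseries => n _ _; exact: measure_ge0.
apply: nearW => n.
under eq_bigr do rewrite FE.
rewrite sumEFin lee_fin.
(* The big sum excludes its upper index and [sum_f_R0] includes it, so the empty sum is treated
   apart. *)
case: n => [|n]; first by rewrite big_geq // ltW.
by rewrite -sum_f_R0E; apply/RleP; exact: Asum.
Qed.

(** Continuity from above: the tails decrease to the empty set, and [trap] has finite area. *)
Lemma area_tail (A : nat -> set T2) : (forall n, measurable (A n)) -> trivIset setT A ->
  (fun k => area (\bigcup_(n in [set n | (k <= n)%N]) A n)) @ \oo --> (0 : R).
Proof.
move=> mA tA.
pose F k : set T2 := (\bigcup_(n in [set n | (k <= n)%N]) A n) `&` (trap : set T2).
have mU k : measurable (\bigcup_(n in [set n | (k <= n)%N]) A n : set T2).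
  by apply: bigcup_measurable => n _; exact: mA.
have mF k : measurable (F k) by apply: measurableI => //; exact: measurable_trap.
have F0 : \bigcap_k F k = set0.
  rewrite -subset0 => z Hz.
  have [[i _ Ai] _] := Hz 0%N I.
  have [[j /= ij Aj] _] := Hz i.+1 I.
  have := tA i j I I (ex_intro _ z (conj Ai Aj)) => E.
  by move: ij; rewrite /= -E ltnn.
have := @nonincreasing_cvg_mu _ _ R leb2 F.
rewrite F0 measure0 => H.
have {}H : (leb2 \o F) @ \oo --> (0 : \bar R)%E.
  apply: H => //.
  - by rewrite -ge0_fin_numE ?measure_ge0 //; exact: leb2_trap_fin.
  - move=> i j ij; apply/subsetPset; apply: setSI.
    by move=> z [n /= jn An]; exists n => //=; exact: leq_trans jn.
have := fine_cvg H; exact.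
Qed.

Theorem has_acip_G : has_acip (G al).
Proof.
have [L [Ladd Lmono Llim]] := generalized_limit R.
have [M M0 HM] := mass_bound.
have a0 := area_gt0.
pose mu (A : set2) : R := L (cesaro A) / area setT.
have mu_ge0 (A : set2) : borel A -> 0 <= mu A.
  move=> /borel_measurable mA; rewrite divr_ge0 ?(ltW a0) //.
  rewrite -(Llim (fun _ => 0) 0 (cvg_cst _)); apply: Lmono.
  - by exists 0 => n; rewrite normr0.
  - exact: bounded_cesaro.
  - by move=> N; exact: cesaro_ge0.
pose K := M / area setT.
have mu_le (A : set T2) : measurable A -> mu A <= K * area A.
  move=> mA; rewrite /mu /K mulrAC ler_pM2r ?invr_gt0 //.
  rewrite -(Llim (fun _ => M * area A) (M * area A) (cvg_cst _)); apply: Lmono.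
  - exact: bounded_cesaro.
  - by exists `|M * area A| => n.
  - by move=> N; apply: cesaro_le => k; exact: HM.
have mu_setU (A B : set T2) : measurable A -> measurable B -> [disjoint A & B] ->
    mu (A `|` B) = mu A + mu B.
  move=> mA mB AB; rewrite /mu cesaro_setU // Ladd; try exact: bounded_cesaro.
  exact: mulrDl.
(* Since [trap] lies in the unit square, this yields the full mass of the square and removes the
   intersection with it in [invariant]. *)
have mu_trap (A B : set T2) : A `&` (trap : set T2) = B `&` (trap : set T2) -> mu A = mu B.
  move=> AB; congr (L _ / _); apply/funext => N; congr (_ / _).
  by apply: eq_bigr => k _; rewrite mass_trap AB -mass_trap.
have mu_T : mu setT = 1.
  rewrite /mu (_ : cesaro setT = fun=> area setT) ?(Llim _ _ (cvg_cst _)).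
    by rewrite divff // gt_eqF.
  apply/funext => N; rewrite /cesaro; under eq_bigr do rewrite mass_setT.
  rewrite sumr_const_nat subn0.
  have cancel (x : R) : x *+ N.+1 / N.+1%:R = x by rewrite -[x *+ _]mulr_natr mulfK ?pnatr_eq0.
  exact: cancel.
exists mu; split; [split; [|split; [|split]]|split].
- by move=> A /mu_ge0 /RleP.
- move=> A bA dA.
  have mA n : measurable (A n : set T2) by exact: borel_measurable.
  have tA : trivIset setT (A : nat -> set T2).
    move=> i j _ _ [z [Ai Aj]]; apply: contrapT => ij; exact: (dA i j z ij Ai Aj).
  pose tail k : set T2 := \bigcup_(n in [set n | (k <= n)%N]) A n.
  have mtail k : measurable (tail k).
    by apply: bigcup_measurable => n _; exact: mA.
  have tailS k : tail k = A k `|` tail k.+1.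
    apply/seteqP; split => z.
      move=> [n /= kn An]; move: kn; rewrite leq_eqVlt => /predU1P[->|kn]; first by left.
      by right; exists n.
    by move=> [Ak|[n /= kn An]]; [exists k => //= | exists n => //=; exact: ltnW].
  have dtail k : [disjoint (A k : set T2) & tail k.+1].
    rewrite disj_set2E; apply/eqP; rewrite -subset0 => z [Ak [n /= kn An]].
    have := tA k n I I (ex_intro _ z (conj Ak An)) => E.
    by move: kn; rewrite E ltnn.
  have split_sum k : mu (tail 0%N) = \sum_(0 <= i < k) mu (A i) + mu (tail k).
    elim: k => [|k IH]; first by rewrite big_geq // add0r.
    rewrite IH big_nat_recr //= [in LHS]tailS mu_setU // addrA //.
  have tail0 : (fun p => exists n, A n p) = tail 0%N.
    by apply/seteqP; split => z [n]; [move=> An; exists n | move=> _ An; exists n].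
  move=> e /RltP e0.
  have K0 : 0 < K by rewrite divr_gt0.
  have eK : 0 < e / K by rewrite divr_gt0.
  have [N _ HN] := cvgr_lt (0 : R) (area_tail mA tA) _ eK.
  exists N => n /ssrnat.leP Nn.
  (* [sum_f_R0] includes the index [n], so the remainder is [mu (tail n.+1)], at most [K] times an
     area that tends to 0. *)
  rewrite tail0 (split_sum n.+1) sum_f_R0E RdistE opprD addrA subrr sub0r normrN.
  have t0 : 0 <= mu (tail n.+1).
    rewrite /mu divr_ge0 ?(ltW a0) //.
    rewrite -(Llim (fun _ => 0) 0 (cvg_cst _)); apply: Lmono.
    + by exists 0 => m; rewrite normr0.
    + exact: bounded_cesaro.
    + by move=> m; exact: cesaro_ge0.
  rewrite ger0_norm //; apply/RltP; apply: (le_lt_trans (mu_le _ (mtail _))).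
  have := HN n.+1 (leq_trans Nn (leqnSn n)).
  by rewrite /= ltr_pdivlMr // mulrC.
- exact: mu_T.
- rewrite (mu_trap _ setT); first exact: mu_T.
  by rewrite setTI; apply/setIidr => z; exact: (trap_unit_square _ al_lo).
- move=> A bA nA; apply/eqP; rewrite eq_le mu_ge0 // andbT.
  by apply: le_trans (mu_le _ (borel_measurable bA)) _; rewrite (area_null bA nA) mulr0.
- move=> A /borel_measurable mA.
  have mGA : measurable (G al @^-1` A : set T2).
    by rewrite -[X in measurable X]setTI; exact: measurable_G.
  rewrite (mu_trap _ (G al @^-1` A : set T2)); last first.
    apply/seteqP; split => z; first by move=> [[_ ?] ?].
    by move=> [GA Tz]; split => //; split => //; exact: (trap_unit_square _ al_lo).
  rewrite /mu; congr (_ / _).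
  have := Llim _ _ (cesaro_G mA) => L0.
  (* [L] is only known to be additive, so the average for the preimage is written as the one for [A]
     plus a sequence with limit 0. *)
  rewrite (_ : cesaro (G al @^-1` A) =
    fun N => cesaro A N + (cesaro (G al @^-1` A) N - cesaro A N)); last first.
    by apply/funext => N; rewrite addrCA subrr addr0.
  rewrite Ladd ?L0 ?addr0 //; first exact: bounded_cesaro.
  have [c1 H1] := bounded_cesaro mGA; have [c2 H2] := bounded_cesaro mA.
  by exists (c1 + c2) => n; apply: le_trans (ler_normB _ _) _; exact: lerD.
Qed.

End Density.

Theorem theorem3 :
  forall alpha2 : R,
    0 <= alpha2 <= 1 ->
    8 * alpha2 ^ 4 - 8 * alpha2 ^ 3 + 8 * alpha2 ^ 2 = 1 / 2 ->
    forall alpha : R, alpha2 <= alpha <= 1 / 3 -> has_acip (G alpha).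
Proof.
intros alpha2 H01 H2 alpha Hal.
destruct (alpha_bounds alpha2 alpha (proj1 H01) H2 Hal) as [Hlo Heq].
exact (has_acip_G Hlo (proj2 Hal) Heq).
Qed.
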